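(* Let $X$ be a Peano continuum with uncountably many cut points. Then $X$ is a topological fractal with witnessing number two.
   Context: A continuum is a nonempty connected compact metrizable space; a Peano continuum is a locally connected continuum. A point $x$ of a connected space $X$ is a cut point if $X\setminus\{x\}$ is not connected. For a set $\mathcal F$ of self-maps of a set $X$ put $\mathcal F^0=\{\mathrm{id}\}$ and, for $n>0$, $\mathcal F^n=\{f_1\circ\dots\circ f_n : f_i\in\mathcal F \text{ for } 1\le i\le n\}$. If $X$ is a metric space, $\mathcal F$ is called topologically contractive if for every $\varepsilon>0$ there exists $k\in\mathbb N$ such that $\operatorname{diam} f(X)<\varepsilon$ for every $f\in\mathcal F^k$ (for compact $X$ this does not depend on the choice of compatible metric). A compact metric (or metrizable, with any compatible metric) space $X$ is a topological fractal if there exists a finite topologically contractive set $\mathcal F$ of continuous self-maps of $X$ with $\bigcup\{f(X): f\in\mathcal F\}=X$. The maps in such an $\mathcal F$ are called witnessing maps, and the smallest cardinality of such a family $\mathcal F$ is called the witnessing number of $X$. *)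

(* Defs.v *)
From HB Require Import structures.
From mathcomp Require Import all_boot all_order all_algebra.
From mathcomp Require Import all_classical all_reals ereal topology.

Set Implicit Arguments.
Unset Strict Implicit.
Unset Printing Implicit Defensive.

Import Order.TTheory GRing.Theory Num.Theory.
Local Open Scope classical_set_scope.
Local Open Scope ring_scope.

Section Continua.
(* A metrizable space is represented by a [metricType R], i.e. by a space
   together with a compatible metric [mdist]; quantifying over all such types
   means quantifying over all metrizable spaces and all metrics compatible with
   their topology. *)
Context {R : realType}.
Variable X : metricType R.

Definition locally_connected_space : Prop :=
  forall (x : X) (U : set X), nbhs x U ->
    exists V : set X, [/\ open V, V x, connected V & V `<=` U].

Definition continuum : Prop :=
  [/\ [set: X] !=set0, connected [set: X] & compact [set: X]].

Definition peano_continuum : Prop := continuum /\ locally_connected_space.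

Definition cut_points : set X := [set x | ~ connected [set~ x]].

End Continua.
Arguments cut_points {R} X _.

Section SelfMaps.
Variable T : Type.

(* [family_iter F n] is the set of all f1 \o ... \o fn with f1, ..., fn in F;
   at n = 1 it is F, since f \o id is convertible to f. *)
Fixpoint family_iter (F : set (T -> T)) (n : nat) : set (T -> T) :=
  if n is m.+1 then [set f \o g | f in F & g in family_iter F m]
  else [set id].

End SelfMaps.

Section TopologicalFractals.
Context {R : realType}.
Variable X : metricType R.

(* The diameter takes values in the extended reals, so that it is +oo (and not
   a junk value) on unbounded sets; on the empty set it is -oo. *)
Definition diam (A : set X) : \bar R :=
  ereal_sup [set (mdist x y)%:E | x in A & y in A].

Definition topologically_contractive (F : set (X -> X)) : Prop :=
  forall e : R, 0 < e ->
    exists k : nat, forall f, family_iter F k f -> (diam (range f) < e%:E)%E.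

Definition witnessing_family (F : set (X -> X)) : Prop :=
  [/\ finite_set F,
      (forall f, F f -> continuous f),
      topologically_contractive F &
      \bigcup_(f in F) range f = [set: X]].

Definition topological_fractal : Prop :=
  compact [set: X] /\ exists F, witnessing_family F.

Definition has_witnessing_number (n : nat) : Prop :=
  (exists2 F, witnessing_family F & (F #= `I_n)%card) /\
  (forall (F : set (X -> X)) (m : nat),
     witnessing_family F -> (F #= `I_m)%card -> (n <= m)%N).

End TopologicalFractals.

(* Main.v *)
Require Import Defs.
From HB Require Import structures.
From mathcomp Require Import all_boot all_order all_algebra.
From mathcomp Require Import all_classical all_reals ereal topology.
From mathcomp Require Import normedtype sequences lra zify.

(** Why the theorem holds. Uncountably many cut points turn [X] into a string
of pieces laid along an interval. Since [X] has a countable dense set, some two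
points [p] and [q] are separated by uncountably many cut points. These are
linearly ordered by the inclusion of the sides containing [p], and an
uncountable family of this kind contains a copy of the dyadic numbers. As in
Urysohn's lemma, the sides of these dyadically indexed points define a
continuous [h] from [X] onto [[0, 1]] ([cut_function]). What is gained over
Urysohn's lemma is the property [cut_between]: for [s < t] a single point lies
on every connected set that goes from [h <= s] to [h >= t]. With local
connectedness it follows that the part [h < t] touches the level set of [t] in
at most one point, its entry, and the part [h > t] in at most one point, its
exit ([closure_lt_unique]); hence a level set with two points has nonempty
interior ([fibre_interior]), and only countably many levels are of that kind.

The two witnessing maps factor through [h]. Suppose that [g] maps [[0, 1]] onto
[X] and that [h \o g] is Lipschitz with constant [3 / 2]. The maps
[x |-> g (h x / 2)] and [x |-> g ((h x + 1) / 2)] together cover [X], because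
[h] is onto [[0, 1]]; each of them multiplies the variation of [h] by at most
[3 / 4]. A long composition is therefore [g] applied to a function of tiny
variation, and uniform continuity of [g] makes its image small
([witnessing_two_halves]).

The path [g] has to run along the string without ever turning back
([monotone_path]). A Peano continuum is the image of a path [gamma] from [p] to
[q] (the Hahn-Mazurkiewicz theorem, [peano_path]), but [gamma] may go back and
forth. So [g] visits the levels in increasing order, and at the level [t] it
performs the whole of [gamma], with everything below [t] pushed to the entry and
everything above [t] to the exit ([fibre_retract]). This needs an interval of
time for each of the countably many levels that are not points, and
[staircase] provides a timetable [phi] that has these intervals as plateaus and
is nevertheless Lipschitz: two thirds of the time are used for proceeding at
constant speed, one third is distributed among the plateaus.

One map never suffices: it would be surjective, and so would all its iterates
([singleton_not_witnessing]). *)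

Set Implicit Arguments.
Unset Strict Implicit.
Unset Printing Implicit Defensive.
Import Order.TTheory GRing.Theory Num.Theory.
Import numFieldNormedType.Exports.
Local Open Scope classical_set_scope.
Local Open Scope ring_scope.

(** * Connected sets and compact metric spaces *)

(** A choice of base point does not affect second countability, and a nonempty
space has one. *)
Lemma second_countable_compact (R : realType) (X : metricType R) :
  [set: X] !=set0 -> compact [set: X] -> @second_countable X.
Proof.
move=> [p _].
pose Y : pseudoPMetricType R :=
  HB.pack (X : Type) (isPointed.Build X p) (PseudoMetric.on X).
exact: (@compact_second_countable R Y).
Qed.

Lemma dense_sequence (X : topologicalType) :
  [set: X] !=set0 -> @second_countable X ->
  exists d : nat -> X, dense (range d).
Proof.
move=> [p _] [B /countable_injP[e einj] [Bop Bbas]].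
pose d n : X := xget p [set x | exists b, [/\ B b, e b = n & b x]].
exists d => U [x Ux] oU.
have [b [Bb bx] bU] := Bbas x U (open_nbhs_nbhs (conj oU Ux)).
exists (d (e b)); split; last by exists (e b).
apply: bU; rewrite /d; case: xgetP => [_ -> [b' [Bb' /einj]]|/(_ x)/= h].
  by rewrite !inE => /(_ Bb' Bb) ->.
by exfalso; apply: h; exists b.
Qed.

(** Every use of connectedness below has this form: a connected set would be
split by two open sets that are disjoint on it, each meeting it. *)
Lemma connected_split (X : topologicalType) (V A B : set X) (x y : X) :
  connected V -> open A -> open B -> V `<=` A `|` B ->
  (forall z, V z -> A z -> B z -> False) -> V x -> A x -> V y -> B y -> False.
Proof.
move=> cV oA oB VAB AB Vx Ax Vy By.
have E : V `&` A = V.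
  apply: cV; first by exists x.
    by exists A.
  exists (~` B); first exact: open_closedC.
  apply/seteqP; split => z [Vz] => [Az|nBz]; split => //.
    exact: AB.
  by case: (VAB z Vz).
have [_ Ay] : (V `&` A) y by rewrite E.
exact: (AB y).
Qed.

Lemma not_connected_setC1 (X : topologicalType) (x : X) :
  accessible_space X -> ~ connected [set~ x] ->
  exists A B : set X, [/\ open A, open B, A !=set0 & B !=set0] /\
    [/\ A `&` B = set0, ~ A x, ~ B x & forall y, y <> x -> A y \/ B y].
Proof.
move=> T1 /existsNP[A /not_implyP[A0 /not_implyP[[C oC AC] /not_implyP[[D cD AD] AX]]]].
have oX : open [set~ x] by apply/closed_openC/accessible_closed_set1.
exists A, ([set~ x] `&` ~` D); split; split => //.
- by rewrite AC; exact: openI.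
- by apply: openI => //; exact: closed_openC.
- apply: contrapT => /set0P/negP/negPn/eqP BE; apply: AX.
  apply/seteqP; split; first by rewrite AC => z [].
  move=> z zx; rewrite AD; split => //; apply: contrapT => Dz.
  by rewrite -[False]/(set0 z) -BE.
- by rewrite AD; apply/seteqP; split => z // [[_ Dz] [_ /(_ Dz)]].
- by rewrite AD => -[/(_ erefl)].
- by case=> /(_ erefl).
- move=> y yx; have [Ay|nAy] := pselect (A y); [by left|right; split => // Dy].
  by apply: nAy; rewrite AD.
Qed.

(** Compactness for a cover in which each point chooses its neighbourhood. The
subcover is a list, so that chains can be built by induction on it. *)
Lemma compact_open_cover (R : realType) (X : metricType R) (V : X -> set X) :
  compact [set: X] -> [set: X] !=set0 -> (forall x, open (V x) /\ V x x) ->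
  exists s : seq X, forall x, exists2 a, a \in s & V a x.
Proof.
move=> + [p _].
pose Y : pseudoPMetricType R :=
  HB.pack (X : Type) (isPointed.Build X p) (PseudoMetric.on X).
rewrite (_ : compact [set: X] = @cover_compact Y [set: X]); last first.
  by rewrite -(@compact_cover Y).
move=> kX VP; have [|x _|D _ XD] := kX Y setT V.
- by move=> x _; case: (VP x).
- by exists x => //; case: (VP x).
- by exists (finmap.enum_fset D) => x; have [a aD Vx] := XD x I; exists a.
Qed.

(** * Points that separate two given points *)

Definition separates (X : topologicalType) (p q x : X) (A B : set X) : Prop :=
  [/\ open A, open B & A `&` B = set0] /\ [/\ A p, B q & [set~ x] = A `|` B].

Lemma separatesC (X : topologicalType) (p q x : X) (A B : set X) :
  separates p q x A B -> separates q p x B A.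
Proof. by move=> [[? ? AB] [? ? E]]; split; split => //; rewrite 1?setIC 1?setUC. Qed.

(** If [y] lies beyond [x], as seen from [p], then the side of [x] that contains
[p], together with [x] itself, is inside that of [y]. This holds whichever separations are chosen
at [x] and [y]: when [x] is in [A'], the set [A `&` B'] is open and closed, and
it misses [p], so it is empty; when [x] is in [B'], the set [A `&` A'] is open
and closed, contains [p] and misses [q], which is absurd. *)
Lemma separates_nested (X : topologicalType) (p q x y : X) (A B A' B' : set X) :
  connected [set: X] -> separates p q x A B -> separates p q y A' B' ->
  B y -> x |` A `<=` A'.
Proof.
move=> cX [[oA oB AB] [Ap Bq ABx]] [[oA' oB' AB'] [Ap' Bq' ABy]] By.
have disj z : A z -> B z -> False by move=> Az Bz; rewrite -[False]/(set0 z) -AB.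
have disj' z : A' z -> B' z -> False by move=> Az Bz; rewrite -[False]/(set0 z) -AB'.
have cov z : z <> x -> A z \/ B z by move=> zx; have : [set~ x] z by []; rewrite ABx.
have cov' z : z <> y -> A' z \/ B' z by move=> zx; have : [set~ y] z by []; rewrite ABy.
have xy : x <> y by move=> xy; have : [set~ x] y; [rewrite ABx; right|apply].
have [A'x|B'x] := cov' x xy; last first.
  exfalso; apply: (@connected_split X setT (A `&` A') (B `|` B') p q) => //.
  - exact: openI.
  - exact: openU.
  - move=> z _; have [->|zx] := pselect (z = x); first by right; right.
    have [->|zy] := pselect (z = y); first by right; left.
    by case: (cov _ zx) (cov' _ zy) => ? [] ?; rewrite /setU/setI/=; tauto.
  - by move=> z _ [? ?] [?|?]; [exact: (disj z)|exact: (disj' z)].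
  - by left.
move=> z [->//|Az].
have [|//|Bz] := cov' z; first by move=> zy; apply: (disj z) => //; rewrite zy.
exfalso; apply: (@connected_split X setT (A `&` B') (B `|` A') z p) => //.
- exact: openI.
- exact: openU.
- move=> t _; have [->|tx] := pselect (t = x); first by right; right.
  have [->|ty] := pselect (t = y); first by right; left.
  by case: (cov _ tx) (cov' _ ty) => ? [] ?; rewrite /setU/setI/=; tauto.
- by move=> t _ [? ?] [?|?]; [exact: (disj t)|exact: (disj' t)].
- by right.
Qed.

(** The points of [T] with only countably many predecessors in [T] form a
countable set: except for a possible last one, each such [z] lies in [A z'] for
another such [z'], hence in a basic open set that contains only countably many
points of [T], and there are only countably many basic open sets. *)
Lemma countable_few_predecessors (X : topologicalType) (T : set X) (A : X -> set X) :
  @second_countable X ->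
  (forall z, T z -> open (A z)) ->
  (forall z z', T z -> T z' -> z <> z' -> A z z' \/ A z' z) ->
  countable [set z | T z /\ countable (T `&` A z)].
Proof.
move=> [B cB [Bop Bbas]] oA tot.
set L := [set z | _].
pose B' := B `&` [set b | exists2 z, L z & b `<=` A z].
have cB' : countable B' by apply: (sub_countable _ cB); apply: subset_card_le => b [].
pose M := \bigcup_(z in L) A z.
have c1 : countable (\bigcup_(b in B') (T `&` b)).
  apply: bigcup_countable => // b [_ [z [Tz cz] bz]].
  by apply: (sub_countable _ cz); apply: subset_card_le; exact: setIS.
have [[m [Lm nm]]|NE] := pselect (exists m, L m /\ ~ M m).
  have : countable ([set m] `|` \bigcup_(b in B') (T `&` b)).
    rewrite -bigcup2E; apply: bigcup_countable => // -[|[|n]] _ //=; exact: countable1.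
  apply: sub_countable; apply: subset_card_le => z Lz.
  have [->|zm] := pselect (z = m); [by left|right].
  have [z' Lz' Az'] : M z.
    case: (tot z m) => //; [by case: Lz|by case: Lm| |by exists m].
    by move=> Azm; case: nm; exists z.
  have [b [Bb bz] bA] := Bbas z _ (open_nbhs_nbhs (conj (oA z' (proj1 Lz')) Az')).
  by exists b; split => //; [exists z'|case: Lz].
apply: sub_countable c1; apply: subset_card_le => z Lz.
have [z' Lz' Az'] : M z by apply: contrapT => nM; apply: NE; exists z.
have [b [Bb bz] bA] := Bbas z _ (open_nbhs_nbhs (conj (oA z' (proj1 Lz')) Az')).
by exists b; split => //; [exists z'|case: Lz].
Qed.

(** [S] is a set of points that separate [p] from [q], with a separation
[A x], [B x] chosen at each of them; [A y x] then says that [x] comes before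
[y] on the way from [p] to [q]. *)
Section Cuts.
Context (X : topologicalType) (p q : X) (S : set X) (A B : X -> set X).
Hypothesis scX : @second_countable X.
Hypothesis cX : connected [set: X].
Hypothesis sepS : forall x, S x -> separates p q x (A x) (B x).

Lemma before_side_subset x y : S x -> S y -> A y x -> x |` A x `<=` A y.
Proof.
move=> Sx Sy Ayx; have [[_ _ dx] [_ _ Ex]] := sepS Sx.
have [[_ _ dy] [_ _ Ey]] := sepS Sy.
have nAx : ~ A x x by move=> Axx; have : [set~ x] x; [rewrite Ex; left|exact].
have : [set~ x] y by move=> /= yx; rewrite yx in Ayx.
rewrite Ex => -[Axy|]; last exact: separates_nested (sepS Sx) (sepS Sy).
have := separates_nested cX (separatesC (sepS Sx)) (separatesC (sepS Sy)) Axy.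
move=> /(_ x (or_introl erefl)) Byx.
by exfalso; rewrite -[False]/(set0 x) -dy.
Qed.

Lemma before_or_after x y : S x -> S y -> x <> y -> A y x \/ B y x.
Proof.
move=> Sx Sy xy; have [_ [_ _ Ey]] := sepS Sy.
by have : [set~ y] x by []; rewrite Ey.
Qed.

Lemma after_before x y : S x -> S y -> B y x -> A x y.
Proof.
move=> Sx Sy Byx.
by apply: (separates_nested cX (sepS Sy) (sepS Sx) Byx); left.
Qed.

Lemma before_after x y : S x -> S y -> A y x -> B x y.
Proof.
move=> Sx Sy Ayx.
have := separates_nested cX (separatesC (sepS Sy)) (separatesC (sepS Sx)) Ayx.
by apply; left.
Qed.

(** Only countably many points of [T] have countably many predecessors, and only
countably many have countably many successors. *)
Lemma cuts_middle (T : set X) : T `<=` S -> ~ countable T ->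
  exists z, [/\ T z, ~ countable (T `&` A z) & ~ countable (T `&` B z)].
Proof.
move=> TS ncT.
have cA : countable [set z | T z /\ countable (T `&` A z)].
  apply: countable_few_predecessors => // [z /TS/sepS[[]]//|z z' /TS Sz /TS Sz' zz'].
  by have [Az|/(after_before Sz Sz')] := before_or_after Sz Sz' zz'; [right|left].
have cB : countable [set z | T z /\ countable (T `&` B z)].
  apply: countable_few_predecessors => // [z /TS/sepS[[]]//|z z' /TS Sz /TS Sz' zz'].
  by have [/(before_after Sz Sz')|] := before_or_after Sz Sz' zz'; [left|right].
apply: contrapT => nz; apply: ncT.
have : countable ([set z | T z /\ countable (T `&` A z)] `|`
                  [set z | T z /\ countable (T `&` B z)]).
  by rewrite -bigcup2E; apply: bigcup_countable => // -[|[|n]] _ //=.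
apply: sub_countable; apply: subset_card_le => z Tz.
have [cAz|ncA] := pselect (countable (T `&` A z)); first by left.
have [cBz|ncB] := pselect (countable (T `&` B z)); first by right.
by case: nz; exists z.
Qed.

(** The relation that can be split for ever: uncountability of the interval
between [x] and [y] is passed on to both halves of some subdivision, whereas
density of the order might fail. *)
Definition wide (x y : X) : Prop :=
  [/\ S x, S y & ~ countable (S `&` (B x `&` A y))].

Lemma wide_split x y : wide x y -> exists z, wide x z /\ wide z y.
Proof.
move=> [Sx Sy /cuts_middle[|z [[Sz _] nA nB]]]; first by move=> ? [].
exists z; split; split => //.
  by move: nA; apply: contra_not; apply: sub_countable;
    apply: subset_card_le => t [[? [? ?]] ?].
by move: nB; apply: contra_not; apply: sub_countable;
  apply: subset_card_le => t [[? [? ?]] ?].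
Qed.

Lemma wide_lt x y : wide x y -> A y x.
Proof.
move=> [Sx Sy nc].
have [z [Sz [Bz Az]]] : (S `&` (B x `&` A y)) !=set0.
  by apply: contrapT => /set0P/negP/negPn/eqP E; apply: nc; rewrite E.
by apply: (before_side_subset Sz Sy Az); right; exact: after_before.
Qed.

Lemma wide_exists : ~ countable S -> exists x y, wide x y.
Proof.
move=> /cuts_middle[//|y [Sy ncA _]].
case/cuts_middle: ncA => [? []//|x [[Sx _] _ ncB]].
exists x, y; split => //; move: ncB; apply: contra_not.
by apply: sub_countable; apply: subset_card_le => t [[? ?] ?].
Qed.

End Cuts.

(** * From a splittable relation to a dyadic chain *)

Lemma dyadic_between (R : realType) (s t : R) : 0 <= s -> s < t -> t <= 1 ->
  exists n k : nat, (k < 2 ^ n)%N /\ s < k%:R / 2 ^+ n < t.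
Proof.
move=> s0 st t1; set n := Num.trunc (t - s)^-1.
have ts0 : 0 < t - s by rewrite subr_gt0.
have nE : (t - s)^-1 < 2 ^+ n.+1.
  apply: lt_le_trans (truncnS_gt _) _; rewrite -/n -natrX ler_nat ltnW//.
  exact: ltn_expl.
have p0 : 0 < 2 ^+ n.+1 :> R by rewrite exprn_gt0.
have nt : 1 < (t - s) * 2 ^+ n.+1 by rewrite -ltr_pdivrMl// mulr1.
have /truncn_itv/andP[k1 k2] : 0 <= s * 2 ^+ n.+1 by rewrite mulr_ge0// ltW.
set k := Num.trunc _ in k1 k2.
have kt : k.+1%:R < t * 2 ^+ n.+1 by rewrite -natr1; lra.
exists n.+1, k.+1; split; last by rewrite ltr_pdivlMr// ltr_pdivrMr// k2.
rewrite -(ltr_nat R) natrX (lt_le_trans kt)// -[leRHS]mul1r ler_wpM2r//.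
Qed.

(** If [W] can be split for ever, inserting a midpoint at every stage indexes a
subset of [T], in the order [lt], by the dyadic fractions in the unit interval. The value
[z r] does not depend on the fraction by which [r] is written, because a stage
keeps the points of the previous one at even indices. *)
Section DyadicChain.
Context (R : realType) (T : Type) (W lt : T -> T -> Prop).
Hypothesis W_lt : forall x y, W x y -> lt x y.
Hypothesis lt_trans : forall y x z, lt x y -> lt y z -> lt x z.
Hypothesis W_split : forall x y, W x y -> exists z, W x z /\ W z y.

Lemma dyadic_chain x0 y0 : W x0 y0 ->
  exists (Q : set R) (z : R -> T),
  [/\ forall r, Q r -> 0 <= r <= 1,
      forall r, Q r -> exists u, W (z r) u,
      forall r r', Q r -> Q r' -> r < r' -> lt (z r) (z r') &
      forall s t, 0 <= s -> s < t -> t <= 1 -> exists2 r, Q r & s < r < t].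
Proof.
move=> Wxy.
have [mid midP] : exists mid : T * T -> T, forall xy,
    W xy.1 xy.2 -> W xy.1 (mid xy) /\ W (mid xy) xy.2.
  have /choice[f fP] : forall xy : T * T, exists z,
      W xy.1 xy.2 -> W xy.1 z /\ W z xy.2.
    move=> xy; have [/W_split[z zP]|nW] := pselect (W xy.1 xy.2); first by exists z.
    by exists xy.1.
  by exists f.
pose fix g (n k : nat) {struct n} : T := if n is m.+1 then
    if odd k then mid (g m k./2, g m k./2.+1) else g m k./2
  else if k == 0%N then x0 else y0.
have gW n k : (k < 2 ^ n)%N -> W (g n k) (g n k.+1).
  elim: n k => [|n IH] k; first by rewrite expn0 ltnS leqn0 => /eqP ->.
  rewrite expnS => kn /=; have k2 : (k./2 < 2 ^ n)%N by lia.
  have [odk|evk] := boolP (odd k); rewrite ?odk ?(negbTE evk) /=.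
    have -> : (uphalf k) = k./2.+1 by lia.
    exact: (midP (g n k./2, g n k./2.+1) (IH _ k2)).2.
  have -> : (uphalf k) = k./2 by lia.
  exact: (midP (g n k./2, g n k./2.+1) (IH _ k2)).1.
(* Points with different denominators are compared at a common stage. *)
have glift m n k : g (m + n)%N (k * 2 ^ m)%N = g n k.
  elim: m => [|m IH]; first by rewrite expn0 muln1.
  rewrite addSn expnS mulnCA mul2n /= odd_double/= half_double; exact: IH.
have glt n k k' : (k < k')%N -> (k' < 2 ^ n)%N -> lt (g n k) (g n k').
  elim: k' => // k' IH; rewrite ltnS leq_eqVlt => /orP[/eqP ->|kk'] kn.
    by apply/W_lt/gW; exact: ltnW.
  apply: lt_trans (IH kk' (ltnW kn)) _.
  by apply/W_lt/gW; exact: ltnW.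
pose Q := [set r : R | exists n k : nat, (k < 2 ^ n)%N /\ r = k%:R / 2 ^+ n].
pose D r x := exists n k : nat, [/\ (k < 2 ^ n)%N, r = k%:R / 2 ^+ n :> R & x = g n k].
have [z zP] : exists z : R -> T, forall r, Q r -> D r (z r).
  have /choice[f fP] : forall r, exists x, Q r -> D r x.
    move=> r; have [[n [k [kn rE]]]|nQ] := pselect (Q r); last by exists x0.
    by exists (g n k) => _; exists n, k.
  by exists f.
have pow0 n : 0 < 2 ^+ n :> R by rewrite exprn_gt0.
exists Q, z; split.
- move=> r [n [k [kn ->]]]; rewrite divr_ge0//= ler_pdivrMr// mul1r -natrX ler_nat.
  exact: ltnW.
- by move=> r /zP[n [k [kn _ ->]]]; eexists; apply: gW.
- move=> r r' /zP[n [k [kn -> ->]]] /zP[n' [k' [kn' -> ->]]].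
  rewrite ltr_pdivrMr// mulrAC ltr_pdivlMr// -!natrX -!natrM ltr_nat => kk'.
  rewrite -(glift n' n k) -(glift n n' k') (addnC n); apply: glt => //.
  by rewrite expnD ltn_pmul2r// expn_gt0.
- move=> s t s0 st t1; have [n [k [kn kst]]] := dyadic_between s0 st t1.
  by exists (k%:R / 2 ^+ n) => //; exists n, k.
Qed.
End DyadicChain.

(** * The function defined by the cut points *)

(** The two sides of a cut point are open, so each contains a term of a dense
sequence. There are only countably many pairs of terms, hence one of them is
separated by uncountably many cut points. *)
Lemma uncountable_separated (R : realType) (X : metricType R) :
  [set: X] !=set0 -> @second_countable X -> ~ countable (cut_points X) ->
  exists p q : X, exists S A B, ~ countable S /\
    forall x, S x -> separates p q x (A x) (B x).
Proof.
move=> X0 scX nc.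
have T1 : accessible_space X by exact/hausdorff_accessible/metric_hausdorff.
have [d dd] := dense_sequence X0 scX.
have [A [B AB]] : exists A B : X -> set X, forall x, cut_points X x ->
    exists n m, separates (d n) (d m) x (A x) (B x).
  have /choice[f fP] : forall x : X, exists AB : set X * set X, cut_points X x ->
      exists n m, separates (d n) (d m) x AB.1 AB.2.
    move=> x; have [cx|ncx] := pselect (cut_points X x); last by exists (set0, set0).
    have [A [B [[oA oB A0 B0] [AB Ax Bx E]]]] := not_connected_setC1 T1 cx.
    exists (A, B) => _.
    have [a [Aa [n _ na]]] := dd A A0 oA; have [b [Bb [m _ mb]]] := dd B B0 oB.
    exists n, m; split; split => //=; rewrite ?na ?mb//.
    by apply/seteqP; split => [y /E//|y [Ay|By] yx]; [rewrite yx in Ay|rewrite yx in By].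
  by exists (fst \o f), (snd \o f).
pose S nm := [set x | cut_points X x /\ separates (d nm.1) (d nm.2) x (A x) (B x)].
have [[[n m] ncS]|cS] := pselect (exists nm, ~ countable (S nm)).
  by exists (d n), (d m), (S (n, m)), A, B; split => // x [].
exfalso; apply: nc.
have : countable (\bigcup_(nm in [set: nat * nat]) S nm).
  apply: bigcup_countable => // nm _; apply: contrapT => ?.
  by apply: cS; exists nm.
apply: sub_countable; apply: subset_card_le => x cx.
by have [n [m ?]] := AB x cx; exists (n, m).
Qed.

(** The space can be cut at a single point between any two levels of [h]. Stated
through connected sets, this does not refer to the two sides of the cut. *)
Definition cut_between (R : realType) (X : metricType R) (h : X -> R) : Prop :=
  forall s t, s < t ->
  exists z, forall (V : set X) a b, connected V ->
    V a -> V b -> h a <= s -> t <= h b -> V z.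

(** Urysohn's construction, applied to the nested open sets [A (z r)] with [r]
dyadic: [h x] is the supremum of the [r] with [x] outside [A (z r)]. The closure
of [A (z r)] adds only the point [z r], which is why a connected set that goes
from one side to the other has to contain [z r]. *)
Lemma cut_function (R : realType) (X : metricType R) :
  continuum X -> ~ countable (cut_points X) ->
  exists (p q : X) (h : X -> R),
  [/\ continuous h, forall x, 0 <= h x <= 1, h p = 0, h q = 1 & cut_between h].
Proof.
move=> [X0 cX kX] nc; have scX := second_countable_compact X0 kX.
have [p [q [S [A [B [ncS sep]]]]]] := uncountable_separated X0 scX nc.
have [x0 [y0 W0]] := wide_exists scX cX sep ncS.
pose lt x y := [/\ S x, S y & A y x].
have [||z0 y1 x1|Q [z [Q01 zW zlt Qd]]] :=
    @dyadic_chain R X (wide S A B) lt _ _ _ _ _ W0.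
- by move=> x y W; case: (W) => Sx Sy _; split => //; exact: (wide_lt cX sep W).
- move=> y x t [Sx Sy Ayx] [_ St Aty]; split => //.
  by apply: (before_side_subset cX sep Sy St Aty); right.
- exact: (wide_split scX cX sep).
have zS r : Q r -> S (z r) by move=> /zW[u []].
have sub r r' : Q r -> Q r' -> r < r' -> z r |` A (z r) `<=` A (z r').
  by move=> Qr Qr' /(zlt _ _ Qr Qr')[? ?]; exact: (before_side_subset cX sep).
(* The element 0 only serves to make the set nonempty. *)
pose H x := [set r | r = 0 \/ Q r /\ ~ A (z r) x].
have Hs x : has_sup (H x).
  split; first by exists 0; left.
  by exists 1 => r [->//|[/Q01/andP[]//]].
pose h x := sup (H x).
have hge x r : Q r -> ~ A (z r) x -> r <= h x.
  by move=> Qr Ar; apply: (ub_le_sup (proj2 (Hs x))); right.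
have hle x r : Q r -> A (z r) x -> h x <= r.
  move=> Qr Ar; apply: ge_sup; first by case: (Hs x).
  move=> r' [->|[Qr' Ar']]; first by case/andP: (Q01 r Qr).
  rewrite leNgt; apply/negP => rr'; apply: Ar'.
  by apply: (sub r r') => //; right.
have h01 x : 0 <= h x <= 1.
  rewrite (ub_le_sup (proj2 (Hs x))) /=; last by left.
  apply: ge_sup; first by case: (Hs x).
  by move=> r [->|[/Q01/andP[]]].
have Ap r : Q r -> A (z r) p by move=> /zS/sep[_ []].
have Bq r : Q r -> ~ A (z r) q.
  by move=> /zS/sep[[_ _ dj] [_ Bq _]] Aq; rewrite -[False]/(set0 q) -dj.
exists p, q, h; split => //.
- move=> x; apply/cvgrPdist_lt => e e0.
  have /andP[hx0 hx1] := h01 x.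
  have up : \forall y \near x, h y < h x + e.
    have [he|he] := ltP 1 (h x + e).
      by near=> y; apply: le_lt_trans he; case/andP: (h01 y).
    have [|r Qr /andP[hr rhe]] := Qd _ _ hx0 _ he; first by rewrite ltrDl.
    have Ar : A (z r) x by apply: contrapT => /(hge _ _ Qr); rewrite leNgt hr.
    have [[oA _ _] _] := sep _ (zS _ Qr).
    apply: filterS (open_nbhs_nbhs (conj oA Ar)) => y /(hle _ _ Qr) hy.
    exact: le_lt_trans rhe.
  have lo : \forall y \near x, h x - e < h y.
    have [he|he] := ltP (h x - e) 0.
      by near=> y; apply: (lt_le_trans he); case/andP: (h01 y).
    have [|r Qr /andP[her rh]] := Qd _ _ he _ hx1; first by rewrite ltrBlDr ltrDl.
    have [r' Qr' /andP[her' r'r]] := Qd _ _ he her (le_trans (ltW rh) hx1).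
    have Br : B (z r') x.
      have nA : ~ A (z r) x by move=> /(hle _ _ Qr); rewrite leNgt rh.
      have [_ [_ _ E]] := sep _ (zS _ Qr').
      have : [set~ z r'] x.
        by move=> xz; apply: nA; apply: (sub r' r) => //; left.
      by rewrite E => -[Ax|//]; exfalso; apply: nA; apply: (sub r' r) => //; right.
    have [[_ oB dj] _] := sep _ (zS _ Qr').
    apply: filterS (open_nbhs_nbhs (conj oB Br)) => y By.
    apply: lt_le_trans her' _; apply: hge => // Ay.
    by rewrite -[False]/(set0 y) -dj.
  near=> y; have h1 : h y < h x + e by near: y.
  have h2 : h x - e < h y by near: y.
  by rewrite ltr_norml; lra.
- apply: contrapT => h0.
  have [||r Qr /andP[_ rh]] := Qd 0 (h p) (lexx _).
  + by rewrite lt_neqAle eq_sym; case/andP: (h01 p) => -> _; rewrite andbT; exact/eqP.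
  + by case/andP: (h01 p).
  + by move: rh; rewrite ltNge hle//; exact: Ap.
- apply: contrapT => h1.
  have [||r Qr /andP[hr _]] := Qd (h q) 1 _ _ (lexx _).
  + by case/andP: (h01 q).
  + by rewrite lt_neqAle; case/andP: (h01 q) => _ ->; rewrite andbT; exact/eqP.
  + by move: hr; rewrite ltNge hge//; exact: Bq.
- move=> s t st.
  have [[s0 t1]|nst] := pselect (0 <= s /\ t <= 1); last first.
    exists p => V a b _ _ _ has tb; exfalso; apply: nst.
    have /andP[a0 _] := h01 a; have /andP[_ b1] := h01 b.
    by split; [exact: le_trans has|exact: le_trans b1].
  have [r' Qr' /andP[sr' r't]] := Qd s t s0 st t1.
  (* The second index [r'] leaves room for [z r] itself: it lies in [A (z r')],
     so it is not the endpoint [b]. *)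
  have [r Qr /andP[sr rr']] := Qd s r' s0 sr' (le_trans (ltW r't) t1).
  exists (z r) => V a b cV Va Vb has tb.
  apply: contrapT => Vz.
  have [[oA oB dj] [_ _ E]] := sep _ (zS _ Qr).
  have Aa : A (z r) a.
    by apply: contrapT => /(hge _ _ Qr); rewrite leNgt (le_lt_trans has sr).
  have nA' : ~ A (z r') b.
    by move=> /(hle _ _ Qr'); rewrite leNgt (lt_le_trans r't tb).
  have cov y : y <> z r -> A (z r) y \/ B (z r) y.
    by move=> yz; have : [set~ z r] y by []; rewrite E.
  apply: (@connected_split X V (A (z r)) (B (z r)) a b) => //.
  - by move=> y Vy; apply: cov => yz; apply: Vz; rewrite -yz.
  - by move=> y _ Ay By; rewrite -[False]/(set0 y) -dj.
  have [||//] := cov b.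
    by move=> bz; apply: nA'; apply: (sub r r') => //; left.
  by move=> Ab; exfalso; apply: nA'; apply: (sub r r') => //; right.
Unshelve. all: by end_near. Qed.

(** * Chains of small connected sets *)

Section Chains.
Context (R : realType) (X : metricType R).

Definition link (e : R) (V : set X) (x y : X) : Prop :=
  [/\ connected V, (forall a b, V a -> V b -> mdist a b <= e), V x & V y].

(** A chain runs through points [w i] of [C], consecutive points lying in a
common small connected set [V i]; the sets [V i] may leave [C], and they cover
[U]. Keeping [U] apart from [C] lets a chain be assembled piece by piece, the
covered part growing at each step. *)
Definition chain_on (e : R) (C U : set X) (n : nat) (w : nat -> X)
    (V : nat -> set X) : Prop :=
  [/\ forall i, (i <= n)%N -> C (w i),
      forall i, (i < n)%N -> link e (V i) (w i) (w i.+1) &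
      forall z, U z -> exists2 i, (i < n)%N & V i z].

Definition chain e C U n x y :=
  exists w V, [/\ w 0%N = x, w n = y & chain_on e C U n w V].

Lemma chain_link e (C V : set X) x y :
  C x -> C y -> link e V x y -> chain e C V 1 x y.
Proof.
move=> Cx Cy Vxy.
exists (fun i => if i is 0%N then x else y), (fun=> V); split => //; split.
- by case=> [|[|]].
- by case.
- by move=> z Vz; exists 0%N.
Qed.

Lemma chain_const e (C : set X) x n : 0 <= e -> C x -> chain e C set0 n x x.
Proof.
move=> e0 Cx; exists (fun=> x), (fun=> [set x]); split => //; split => // i _.
by split => //; [exact: connected1|move=> a b /= -> ->; rewrite mdistxx].
Qed.

Lemma chain_cat e (C U U' : set X) n n' x y z :
  chain e C U n x y -> chain e C U' n' y z -> chain e C (U `|` U') (n + n') x z.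
Proof.
move=> [w [V [w0 wn [Cw lw cw]]]] [w' [V' [w'0 w'n [Cw' lw' cw']]]].
exists (fun i => if (i < n)%N then w i else w' (i - n)%N).
exists (fun i => if (i < n)%N then V i else V' (i - n)%N).
split.
- case: ltnP => // n0; rewrite sub0n w'0 -wn -w0; congr (w _); lia.
- by rewrite ifF; [rewrite addKn|lia].
- split.
  + by move=> i ?; case: ltnP => ?; [apply: Cw; lia|apply: Cw'; lia].
  + move=> i ?; case: ltnP => ilt; last by rewrite ifF ?subSn//; [apply: lw'|]; lia.
    case: ltnP => ilt'; first exact: lw.
    have -> : (i.+1 - n = 0)%N by lia.
    have E : i.+1 = n by lia.
    by rewrite w'0 -wn -[in w n]E; exact: lw.
  + move=> t [/cw[i ilt Vi]|/cw'[i ilt Vi]].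
      by exists i; [lia|rewrite ilt].
    by exists (n + i)%N; [lia|rewrite ifF ?addKn//; lia].
Qed.

Lemma chain_sub e (C U U' : set X) n x y : U' `<=` U ->
  chain e C U n x y -> chain e C U' n x y.
Proof.
move=> UU' [w [V [w0 wn [Cw lw cw]]]]; exists w, V; split => //; split => //.
by move=> z /UU'/cw.
Qed.

Hypothesis lcX : locally_connected_space X.

(** The link from a point to itself records that [V] is a small connected
neighbourhood. *)
Lemma small_connected_nbhs e x : 0 < e ->
  exists V : set X, open V /\ link e V x x.
Proof.
move=> e0; have e2 : 0 < e / 2 by rewrite divr_gt0.
have [V [oV Vx cV Vb]] := lcX (nbhsx_ballx x (e / 2) e2).
exists V; split => //; split => // a b /Vb + /Vb.
rewrite ballEmdist /= => xa xb; have := metric_triangle a x b.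
by rewrite (metric_sym a x); lra.
Qed.

(** The points that can be reached from [x] by a chain in [C] form a relatively
open subset of [C], and so do the points that cannot: a small connected
neighbourhood links all its points. *)
Lemma chain_connected e (C : set X) x y : 0 < e -> connected C -> C x -> C y ->
  exists n, chain e C set0 n x y.
Proof.
move=> e0 cC Cx Cy; apply: contrapT => nxy.
pose E := [set z | C z /\ exists n, chain e C set0 n x z].
pose O (F : set X) := \bigcup_(V in [set V | open V /\
  exists2 z, F z & link e V z z]) V.
have oO F : open (O F) by apply: bigcup_open => V [].
have sO F : F `<=` O F.
  by move=> z Fz; have [V [oV lV]] := small_connected_nbhs z e0; exists V;
    [split => //; exists z|case: lV].
apply: (@connected_split X C (O E) (O (C `\` E)) x y) => //.
- move=> z Cz; have [Ez|nEz] := pselect (E z); [left|right]; exact: sO.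
- move=> z Cz [V [_ [a [Ca [n xa]] [cV sV Va _]]] Vz].
  move=> [W [_ [b [Cb nEb] [cW sW Wb _]]] Wz]; apply: nEb; split => //.
  have az : chain e C V 1 a z by apply: chain_link.
  have zb : chain e C W 1 z b by apply: chain_link.
  exists (n + 1 + 1)%N; apply: chain_sub (chain_cat (chain_cat xa az) zb).
  by move=> t [].
- apply: sO; split => //; exists 0%N; apply: chain_const => //; exact: ltW.
- by apply: sO; split => // -[].
Qed.

(** A finite cover by small connected sets is made part of the chain one set at
a time, by a detour to a point that the set shares with [C]; sets that miss [C]
are left out. *)
Lemma chain_cover e (C : set X) x y : 0 < e -> compact [set: X] ->
  connected C -> C x -> C y -> exists n, chain e C C n x y.
Proof.
move=> e0 kX cC Cx Cy.
have /choice[V VP] : forall x, exists V : set X, open V /\ link e V x x.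
  by move=> z; exact: small_connected_nbhs.
have [D XD] : exists s : seq X, forall z, exists2 a, a \in s & V a z.
  apply: compact_open_cover => //; first by exists x.
  by move=> z; case: (VP z) => ? [].
suff: forall s : seq X, forall x, C x ->
    exists n, chain e C (C `&` [set z | exists2 a, a \in s & V a z]) n x y.
  move=> /(_ D x Cx)[n nC]; exists n; apply: chain_sub nC => z Cz.
  by split => //; have [a aD Va] := XD z; exists a.
elim=> [|a s IH] t Ct.
  have [n nC] := chain_connected e0 cC Ct Cy.
  by exists n; apply: chain_sub nC => z [_ []].
have [[c [Cc Vc]]|nC] := pselect (exists c, C c /\ V a c).
  have [n nC] := chain_connected e0 cC Ct Cc.
  have [m mC] := IH c Cc; have [_ [cV sV Va _]] := VP a.
  have cc : chain e C (V a) 1 c c by apply: chain_link.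
  exists (n + 1 + m)%N; apply: chain_sub (chain_cat (chain_cat nC cc) mC).
  move=> z [Cz [b]]; rewrite inE => /predU1P[->|bs Vb]; first by left; right.
  by right; split => //; exists b.
have [n tC] := IH t Ct; exists n; apply: chain_sub tC => z [Cz [b]].
rewrite inE => /predU1P[->|bs Vb]; last by split => //; exists b.
by move=> Vz; case: nC; exists z.
Qed.

End Chains.

Section Refine.
Context (R : realType) (X : metricType R).
Hypothesis lcX : locally_connected_space X.
Hypothesis kX : compact [set: X].
Hypothesis cX : connected [set: X].

Lemma chain_pad e (C U : set X) n m x y : 0 <= e -> C y -> (n <= m)%N ->
  chain e C U n x y -> chain e C U m x y.
Proof.
move=> e0 Cy nm nC; rewrite -(subnKC nm).
by apply: chain_sub (chain_cat nC (chain_const _ e0 Cy)); exact: subsetUl.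
Qed.

(** Each link of a chain is replaced by a chain of smaller links through the
same connected set. Padding gives all these chains the same length [M], so that
the [i]-th link is refined exactly by the indices from [i * M] to [i * M + M].
*)
Lemma chain_refine (e e' : R) N (w : nat -> X) V : 0 < e' ->
  chain_on e setT setT N w V ->
  exists M w' V', [/\ (0 < M)%N, chain_on e' setT setT (N * M) w' V',
    w' 0%N = w 0%N, w' (N * M)%N = w N &
    forall i j, (i < N)%N -> (j < M)%N -> V i (w' (i * M + j)%N)].
Proof.
move=> e'0 [_ lw cw].
have /choice[n nP] : forall i, exists n, (i < N)%N ->
    chain e' (V i) (V i) n (w i) (w i.+1).
  move=> i; case: ltnP => iN; last by exists 0%N.
  have [cV _ Vi Vi'] := lw _ iN.
  by have [n nC] := chain_cover lcX e'0 kX cV Vi Vi'; exists n.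
pose M := (\max_(i < N) n i).+1.
have /choice[f fP] : forall i, exists f : (nat -> X) * (nat -> set X),
    f.1 0%N = w i /\
    ((i < N)%N -> f.1 M = w i.+1 /\ chain_on e' (V i) (V i) M f.1 f.2).
  move=> i; case: (ltnP i N) => iN; last by exists (fun=> w i, fun=> set0).
  have [_ _ _ Vi'] := lw _ iN.
  have nM : (n i <= M)%N by apply/leqW/(leq_bigmax (Ordinal iN)).
  have [w' [V' [w'0 w'M cw']]] := chain_pad (ltW e'0) Vi' nM (nP _ iN).
  by exists (w', V'); split.
pose w' k := (f (k %/ M)%N).1 (k %% M)%N.
pose V' k := (f (k %/ M)%N).2 (k %% M)%N.
have f0 i : (f i).1 0%N = w i by case: (fP i).
have M0 : (0 < M)%N by [].
have w'E i j : (j < M)%N -> w' (i * M + j)%N = (f i).1 j.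
  by move=> jM; rewrite /w' divnMDl// modnMDl divn_small// addn0 modn_small.
have V'E i j : (j < M)%N -> V' (i * M + j)%N = (f i).2 j.
  by move=> jM; rewrite /V' divnMDl// modnMDl divn_small// addn0 modn_small.
have w'S i j : (i < N)%N -> (j < M)%N -> w' (i * M + j).+1 = (f i).1 j.+1.
  move=> iN jM; have [jM'|Mj] := ltnP j.+1 M; first by rewrite -addnS w'E.
  have -> : ((i * M + j).+1 = i.+1 * M + 0)%N by rewrite mulSn; lia.
  rewrite w'E// f0; have -> : j.+1 = M by apply/eqP; rewrite eqn_leq jM Mj.
  by have [_ /(_ iN)[]] := fP i.
exists M, w', V'; split => //.
- split => //.
  + move=> k kNM; have iN : (k %/ M < N)%N by rewrite ltn_divLR.
    have jM : (k %% M < M)%N by rewrite ltn_mod.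
    rewrite [in w' k.+1](divn_eq k M) w'S// -/(w' k).
    by have [_ /(_ iN)[_ [_ + _]]] := fP (k %/ M)%N; apply.
  + move=> z _; have [i iN Vz] := cw z I.
    have [_ /(_ iN)[_ [_ _ /(_ z Vz)[j jM V'z]]]] := fP i.
    exists (i * M + j)%N; last by rewrite V'E.
    by apply: (@leq_trans (i.+1 * M)); [rewrite mulSn; lia|rewrite leq_mul2r iN orbT].
- by rewrite -[0%N]/(0 * M + 0)%N w'E.
- by rewrite -[(N * M)%N]addn0 w'E.
- move=> i j iN jM; rewrite w'E//.
  by have [_ /(_ iN)[_ [+ _ _]]] := fP i; apply; exact: ltnW.
Qed.

Lemma chain_sequence p q : exists (N M : nat -> nat) (w : nat -> nat -> X)
    (V : nat -> nat -> set X),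
  forall k, [/\ (0 < M k)%N, N k.+1 = (N k * M k)%N,
    chain_on ((2^-1) ^+ k) setT setT (N k) (w k) (V k),
    w k 0%N = p /\ w k (N k) = q &
    forall i j, (i < N k)%N -> (j < M k)%N -> V k i (w k.+1 (i * M k + j)%N)].
Proof.
have e0 k : 0 < (2^-1 : R) ^+ k by rewrite exprn_gt0// invr_gt0.
pose S : Type := (nat * (nat -> X) * (nat -> set X))%type.
pose good k (s : S) := chain_on ((2^-1) ^+ k) setT setT s.1.1 s.1.2 s.2 /\
  s.1.2 0%N = p /\ s.1.2 s.1.1 = q.
pose next (s s' : S) (M : nat) := [/\ (0 < M)%N, s'.1.1 = (s.1.1 * M)%N &
  forall i j, (i < s.1.1)%N -> (j < M)%N -> s.2 i (s'.1.2 (i * M + j)%N)].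
have [s0 s0P] : exists s, good 0%N s.
  have [n [w [V [w0 wn cw]]]] := @chain_cover R X lcX _ setT p q (e0 0%N) kX cX I I.
  by exists (n, w, V).
have /choice[f fP] : forall ks : nat * S, exists sM : S * nat,
    good ks.1 ks.2 -> good ks.1.+1 sM.1 /\ next ks.2 sM.1 sM.2.
  move=> [k [[N w] V]]; have [[cw [w0 wN]]|] := pselect (good k (N, w, V)); last first.
    by exists ((N, w, V), 0%N).
  have [M [w' [V' [M0 cw' w'0 w'N VP]]]] := chain_refine (e0 k.+1) cw.
  by exists ((N * M, w', V'), M)%N => _; split => //; split => //=; rewrite w'0 w'N.
pose fix s k := if k is k'.+1 then (f (k', s k')).1 else s0.
have sP k : good k (s k) by elim: k => // k gk; exact: (fP (k, s k) gk).1.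
exists (fun k => (s k).1.1), (fun k => (f (k, s k)).2),
  (fun k => (s k).1.2), (fun k => (s k).2).
by move=> k; have [_ [M0 NE VP]] := fP (k, s k) (sP k); have [] := sP k.
Qed.

End Refine.

(** * The Hahn-Mazurkiewicz theorem *)

Section Clamp.
Context (R : realType).
Implicit Types u v : R.

Definition clamp u : R := if u <= 0 then 0 else if 1 <= u then 1 else u.

Lemma clamp_itv u : 0 <= clamp u <= 1.
Proof. by rewrite /clamp; case: (leP u 0); case: (leP 1 u); lra. Qed.

Lemma clamp_id u : 0 <= u <= 1 -> clamp u = u.
Proof. by rewrite /clamp; case: (leP u 0); case: (leP 1 u); lra. Qed.

Lemma clamp_le0 u : u <= 0 -> clamp u = 0.
Proof. by rewrite /clamp => ->. Qed.

Lemma clamp_ge1 u : 1 <= u -> clamp u = 1.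
Proof. by rewrite /clamp; case: (leP u 0); case: (leP 1 u); lra. Qed.

Lemma clamp_contract u v : clamp v - clamp u <= `|v - u|.
Proof.
have := ler_norm (v - u); have := normr_ge0 (v - u); rewrite /clamp.
by case: (leP u 0); case: (leP 1 u); case: (leP v 0); case: (leP 1 v); lra.
Qed.

End Clamp.

(** At stage [k] the interval [[0, 1]] is divided
into [N k] equal parts, and the path is at the point [w k i] during the [i]-th
part. The division at stage [k.+1] refines that at stage [k], and the points of
the new stage stay in the links of the old one, so the stages are a uniform
Cauchy sequence; consecutive parts are mapped to close points, so the limit is
continuous; it is onto because the links of each stage cover [X]. Constant
extension beyond [[0, 1]] makes the path total. *)
Lemma peano_path (R : realType) (X : metricType R) (p q : X) :
  peano_continuum X -> exists gamma : R -> X,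
  [/\ continuous gamma, forall u, u <= 0 -> gamma u = p,
      forall u, 1 <= u -> gamma u = q &
      forall x, exists2 u, 0 <= u <= 1 & gamma u = x].
Proof.
move=> [[_ cX kX] lcX].
have [N [M [w [V NP]]]] := chain_sequence lcX kX cX p q.
pose e k := (2^-1 : R) ^+ k.
have e0 k : 0 < e k by rewrite /e exprn_gt0// invr_gt0.
have eS k : e k = 2 * e k.+1 by rewrite /e exprS; lra.
have N0 k : (0 < N k)%N.
  by have [_ _ [_ _ /(_ p I)[i iN _]] _ _] := NP k; exact: leq_ltn_trans iN.
have N0R k : 0 < (N k)%:R :> R by rewrite ltr0n.
pose idx k (u : R) := Num.trunc (u * (N k)%:R).
pose y k (u : R) := w k (idx k u).
have idxP k u : 0 <= u -> (idx k u)%:R <= u * (N k)%:R < (idx k u).+1%:R.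
  by move=> u0; apply: truncn_itv; rewrite mulr_ge0// ltW.
have idx_lt k u : 0 <= u -> u < 1 -> (idx k u < N k)%N.
  move=> u0 u1; have /andP[ku _] := idxP k u u0.
  by rewrite -(ltr_nat R) (le_lt_trans ku)// gtr_pMl.
have y0 k : y k 0 = p by rewrite /y /idx mul0r truncn0; case: (NP k) => _ _ _ [].
have y1 k : y k 1 = q by rewrite /y /idx mul1r natrK; case: (NP k) => _ _ _ [].
have linkd k i a b : (i < N k)%N -> V k i a -> V k i b -> mdist a b <= e k.
  by move=> iN; case: (NP k) => _ _ [_ /(_ i iN)[_ + _ _] _] _ _; apply.
(* At time 1 the index is [N k], which is the end of the chain and not the start
   of a link; elsewhere both stages lie in the same link of stage [k]. *)
have yS k u : 0 <= u <= 1 -> mdist (y k u) (y k.+1 u) <= e k.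
  move=> /andP[u0]; rewrite le_eqVlt => /predU1P[->|u1].
    by rewrite !y1 mdistxx ltW.
  have iN := idx_lt k u u0 u1; apply: (linkd k _ _ _ iN).
    by case: (NP k) => _ _ [_ /(_ _ iN)[]].
  have [Mk NE _ _ VP] := NP k.
  have M0R : 0 < (M k)%:R :> R by rewrite ltr0n.
  have -> : y k.+1 u = w k.+1 (idx k u * M k + idx k.+1 u %% M k)%N.
    rewrite /y; congr (w _ _); rewrite {1}(divn_eq (idx k.+1 u) (M k)).
    congr (_ * _ + _)%N; symmetry; apply: truncn_def.
    have := idxP k.+1 u u0; rewrite NE natrM mulrA.
    set n := idx _ _ => /andP[n1 n2]; apply/andP; split.
      rewrite -(ler_pM2r M0R) (le_trans _ n1)// -natrM ler_nat; exact: leq_divM.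
    rewrite -(ltr_pM2r M0R) (lt_le_trans n2)// -natrM ler_nat.
    exact: ltn_ceil.
  by apply: VP => //; rewrite ltn_mod.
have ycauchy k m u : 0 <= u <= 1 -> mdist (y k u) (y (k + m)%N u) <= 2 * e k.
  move=> u01; apply: (@le_trans _ _ (2 * e k - 2 * e (k + m)%N)); last first.
    by have := e0 (k + m)%N; lra.
  elim: m => [|m IH]; first by rewrite addn0 mdistxx subrr.
  rewrite addnS; have := metric_triangle (y k u) (y (k + m)%N u) (y (k + m).+1 u).
  by have := yS (k + m)%N u u01; have := eS (k + m)%N; lra.
(* A cluster point of the stages, which exists by compactness, is their limit. *)
have /choice[g gP] : forall u, exists x, 0 <= u <= 1 ->
    forall k, mdist x (y k u) <= 2 * e k.
  move=> u; have [u01|nu] := pselect (0 <= u <= 1); last by exists p.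
  have [|x [_ cx]] := kX ((fun n => y n u) @ \oo) _.
    by apply: filterT.
  exists x => _ k; apply/ler_addgt0Pl => d d0.
  have [_ [[m km <-] xm]] : [set y n u | n in [set n | (k <= n)%N]] `&` ball x d !=set0.
    apply: cx; last exact: nbhsx_ballx.
    by exists k => // n /= kn; exists n.
  move: xm; rewrite ballEmdist /= => xm.
  have := metric_triangle x (y m u) (y k u); have := ycauchy k (m - k)%N u u01.
  by rewrite subnKC// (metric_sym (y k u)); lra.
have esmall d : 0 < d -> exists k, 5 * e k < d.
  move=> d0; exists (Num.trunc (5 / d)).+1; rewrite /e exprVn ltr_pdivrMr ?exprn_gt0//.
  rewrite mulrC -ltr_pdivrMr//; apply: lt_le_trans (truncnS_gt _) _.
  by rewrite -natrX ler_nat ltnW// ltn_expl.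
have eqd x z : (forall k, mdist x z <= 5 * e k) -> x = z.
  move=> xz; apply/eqP; apply: contraT; rewrite -mdist_gt0 => /esmall[k].
  by rewrite ltNge xz.
have g0 : g 0 = p.
  apply: eqd => k; have := gP 0 _ k; rewrite y0 lexx ler01 => /(_ isT).
  by have := e0 k; lra.
have g1 : g 1 = q.
  apply: eqd => k; have := gP 1 _ k; rewrite y1 lexx ler01 => /(_ isT).
  by have := e0 k; lra.
have step k u v : 0 <= u -> u <= v -> v <= 1 -> v - u < (N k)%:R^-1 ->
    mdist (y k u) (y k v) <= e k.
  move=> u0 uv v1 vu; have v0 := le_trans u0 uv.
  have uvN : u * (N k)%:R <= v * (N k)%:R by rewrite ler_pM2r.
  have vN : v * (N k)%:R <= (N k)%:R by rewrite ger_pMl.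
  have vuN : v * (N k)%:R < u * (N k)%:R + 1.
    by move: vu; rewrite -[_^-1]mul1r ltr_pdivlMr// mulrBl; lra.
  have /andP[iu ui] := idxP k u u0; have /andP[jv vj] := idxP k v v0.
  have ij : (idx k u < (idx k v).+1)%N.
    by rewrite -(ltr_nat R); lra.
  have ji : (idx k v < (idx k u).+2)%N.
    by rewrite -(ltr_nat R) -natr1; lra.
  have jN : (idx k v <= N k)%N by rewrite -(ler_nat R); lra.
  have [E|E] : idx k v = idx k u \/ idx k v = (idx k u).+1.
    by move: ij ji; move: (idx k u) (idx k v) => i j; clear; lia.
    by rewrite /y E mdistxx ltW.
  have iN : (idx k u < N k)%N by rewrite -E.
  rewrite /y E; case: (NP k) => _ _ [_ /(_ _ iN)[_ sV Vi Vi'] _] _ _.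
  exact: sV.
(* 5 = 2 + 1 + 2: from the limit to stage [k], one link, and back. *)
have gclose k u v : 0 <= u -> u <= v -> v <= 1 -> v - u < (N k)%:R^-1 ->
    mdist (g u) (g v) <= 5 * e k.
  move=> u0 uv v1 vu.
  have gu : mdist (g u) (y k u) <= 2 * e k by apply: gP; rewrite u0 (le_trans uv).
  have gv : mdist (g v) (y k v) <= 2 * e k by apply: gP; rewrite v1 (le_trans u0).
  have := metric_triangle (g u) (y k u) (g v).
  have := metric_triangle (y k u) (y k v) (g v).
  by have := step k u v u0 uv v1 vu; rewrite (metric_sym (y k v)); lra.
have gcont : continuous (g \o @clamp R).
  move=> u; apply/metricType_numDomainType.cvgrPdist_lt => d /esmall[k kd].
  have Nk : 0 < (N k)%:R^-1 :> R by rewrite invr_gt0.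
  apply: filterS (nbhsx_ballx u _ Nk) => v; rewrite /ball/= => uv.
  apply: le_lt_trans kd; have vu := uv; rewrite distrC in vu.
  have {vu} := le_lt_trans (clamp_contract u v) vu.
  have {uv} := le_lt_trans (clamp_contract v u) uv.
  have /andP[u0 u1] := clamp_itv u; have /andP[v0 v1] := clamp_itv v.
  have [cuv|/ltW cuv] := leP (clamp u) (clamp v).
    by move=> _; exact: gclose.
  by move=> + _; rewrite metric_sym; exact: gclose.
exists (g \o @clamp R); split => //.
- by move=> u u0 /=; rewrite clamp_le0.
- by move=> u u1 /=; rewrite clamp_ge1.
- move=> x; pose G := (g \o @clamp R) @` `[0, 1].
  have kG : compact G.
    by apply: continuous_compact (@segment_compact _ _ _); exact: continuous_subspaceT.
  have cG : closed G by exact: compact_closed (@metric_hausdorff _ _) kG.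
  have [u u01 <-] : G x.
    apply: cG => B /nbhs_ballP[d /= d0 dB].
    have [k kd] := esmall d d0; have [_ _ [_ _ /(_ x I)[i iN Vx]] _ _] := NP k.
    pose u : R := i%:R / (N k)%:R.
    have u01 : 0 <= u <= 1.
      by rewrite divr_ge0//= ler_pdivrMr// mul1r ler_nat ltnW.
    exists (g (clamp u)); split; first by exists u => //=; rewrite in_itv.
    apply: dB; rewrite ballEmdist /= clamp_id//; apply: le_lt_trans kd.
    have yu : y k u = w k i by rewrite /y /idx mulfVK ?gt_eqF// natrK.
    have xy : mdist x (y k u) <= e k.
      by rewrite yu; apply: (linkd k i) => //; case: (NP k) => _ _ [_ /(_ _ iN)[]].
    have := metric_triangle x (y k u) (g u); have := gP u u01 k.
    by have := e0 k; rewrite (metric_sym (g u)); lra.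
  by exists u => //; rewrite in_itv /= in u01.
Qed.

(** * Monotone maps with prescribed plateaus *)

(** The measure on [nat] that gives [i] the mass [2 ^- i.+1], which is finite and
charges every point. The supremum of the partial sums is used as its value. *)
Section DyadicWeight.
Context (R : realType).
Implicit Types P Q : pred nat.

Definition dyadic_partial P (n : nat) : R := \sum_(i < n | P i) (2^-1) ^+ i.+1.
Definition dyadic_weight P : R := sup (range (dyadic_partial P)).

Let half_gt0 n : 0 < (2^-1 : R) ^+ n. Proof. by rewrite exprn_gt0// invr_gt0. Qed.

Lemma dyadic_partial_le1 P n : dyadic_partial P n <= 1.
Proof.
apply: (@le_trans _ _ (1 - (2^-1) ^+ n)); last by rewrite gerBl ltW.
rewrite /dyadic_partial big_mkcond; elim: n => [|n IH].
  by rewrite big_ord0 expr0 subrr.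
rewrite big_ord_recr/=; case: (P n); rewrite !exprS; have := half_gt0 n; lra.
Qed.

Lemma has_sup_dyadic P : has_sup (range (dyadic_partial P)).
Proof.
split; first by exists (dyadic_partial P 0), 0%N.
by exists 1 => _ [n _ <-]; exact: dyadic_partial_le1.
Qed.

Lemma dyadic_weight_ge0 P : 0 <= dyadic_weight P.
Proof.
apply: (ub_le_sup (proj2 (has_sup_dyadic P))); exists 0%N => //.
by rewrite /dyadic_partial big_ord0.
Qed.

Lemma dyadic_weight_le1 P : dyadic_weight P <= 1.
Proof.
apply: ge_sup; first by case: (has_sup_dyadic P).
by move=> _ [n _ <-]; exact: dyadic_partial_le1.
Qed.

Lemma dyadic_weight_le P Q : (forall i, P i -> Q i) ->
  dyadic_weight P <= dyadic_weight Q.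
Proof.
move=> PQ; apply: ge_sup; first by case: (has_sup_dyadic P).
move=> _ [n _ <-]; apply: (@le_trans _ _ (dyadic_partial Q n)).
  rewrite /dyadic_partial big_mkcond [leRHS]big_mkcond; apply: ler_sum => i _.
  by have := PQ i; case: (P i) => [->//|_]; case: (Q i) => //; exact: ltW.
by apply: (ub_le_sup (proj2 (has_sup_dyadic Q))); exists n.
Qed.

Lemma dyadic_weight_lt P Q n : (forall i, P i -> Q i) -> ~~ P n -> Q n ->
  dyadic_weight P < dyadic_weight Q.
Proof.
move=> PQ Pn Qn; rewrite -(ltrD2r ((2^-1) ^+ n.+1)).
apply: (@le_lt_trans _ _ (dyadic_weight Q)); last by rewrite ltrDl.
rewrite -lerBrDr; apply: ge_sup; first by case: (has_sup_dyadic P).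
move=> _ [m _ <-]; rewrite lerBrDr; pose N := (maxn m n.+1).
apply: (@le_trans _ _ (dyadic_partial Q N)); last first.
  by apply: (ub_le_sup (proj2 (has_sup_dyadic Q))); exists N.
have nN : (n < N)%N by rewrite /N; lia.
have mN : (m <= N)%N by rewrite /N; lia.
rewrite /dyadic_partial (big_ord_widen_cond N P (fun i => (2^-1) ^+ i.+1))//.
rewrite [leRHS](bigD1 (Ordinal nN))//= [leLHS]addrC; apply: lerD => //.
rewrite big_mkcond [leRHS]big_mkcond; apply: ler_sum => i _.
case: ifP => [/andP[Pi _]|_]; last by case: ifP => // _; exact: ltW.
rewrite (PQ _ Pi)/=; case: eqP => //= iE.
by move: Pn; rewrite -[n]/(nat_of_ord (Ordinal nN)) -iE Pi.
Qed.

End DyadicWeight.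

(** The map [phi] is the inverse of the strictly increasing function whose value
at [t] is [2 / 3 * t] plus a third of the mass of the indices [n] with
[d n < t]. The jumps of that function, from [a t] to [b t], occur exactly at the
terms of [d] and become the plateaus of [phi], and its slope is at least
[2 / 3]. *)
Lemma staircase (R : realType) (d : nat -> R) :
  exists phi a b : R -> R,
  [/\ {homo phi : u v / u <= v},
      forall u v, `|phi u - phi v| <= 3 / 2 * `|u - v|,
      forall u, 0 <= phi u <= 1,
      forall t, 0 <= t <= 1 -> [/\ 0 <= a t, a t <= b t, b t <= 1 &
        forall u, a t <= u <= b t -> phi u = t] &
      forall n, a (d n) < b (d n)].
Proof.
pose wa t := dyadic_weight R (fun i => d i < t).
pose wb t := dyadic_weight R (fun i => d i <= t).
pose a t := 2 / 3 * t + 1 / 3 * wa t.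
pose b t := 2 / 3 * t + 1 / 3 * wb t.
have wab t : wa t <= wb t by apply: dyadic_weight_le => i; exact: ltW.
have wba s t : s < t -> wb s <= wa t.
  by move=> st; apply: dyadic_weight_le => i /le_lt_trans; exact.
have ab t : a t <= b t by have := wab t; rewrite /a /b; lra.
have ba s t : s < t -> b s + 2 / 3 * (t - s) <= a t.
  by move=> /wba; rewrite /a /b; lra.
(* [sp u t] says that the increasing function jumps over, or takes, the value
   [u] at [t]; uniqueness of such a [t] is part of [spread]. *)
pose sp u t := [/\ 0 <= t <= 1, forall s, 0 <= s < t -> b s <= u &
  forall s, t < s <= 1 -> u <= a s].
have [phi phiP] : exists phi : R -> R, forall u, sp u (phi u).
  suff /choice[f fP] : forall u, exists t, sp u t by exists f.
  move=> u; pose H := [set s | s = 0 \/ 0 <= s <= 1 /\ a s <= u].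
  have Hs : has_sup H.
    by split; [exists 0; left|exists 1 => r [->//|[/andP[]]]].
  exists (sup H); split.
  - rewrite (ub_le_sup (proj2 Hs)) /=; last by left.
    by apply: ge_sup; [case: Hs|move=> r [->|[/andP[]]]].
  - move=> s /andP[s0 sH].
    have [r Hr sr] := sup_gt (proj1 Hs) sH.
    case: Hr sr => [->|[_ ar] sr]; first by rewrite ltNge s0.
    by have := ba _ _ sr; lra.
  - move=> s /andP[Hs' s1]; rewrite leNgt; apply/negP => au.
    have : s <= sup H.
      have s0 : 0 <= s.
        by apply: le_trans (ltW Hs'); apply: (ub_le_sup (proj2 Hs)); left.
      by apply: (ub_le_sup (proj2 Hs)); right; split; [rewrite s0|exact: ltW].
    by rewrite leNgt Hs'.
have spread u v t t' : sp u t -> sp v t' -> t < t' -> 2 / 3 * (t' - t) <= v - u.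
  move=> [/andP[t0 t1] _ ut] [/andP[t0' t1'] vt' _] tt'.
  have vb s : t < s < t' -> b s <= v by move=> /andP[ts st]; apply: vt'; lra.
  have ua s : t < s < t' -> u <= a s by move=> /andP[ts st]; apply: ut; lra.
  rewrite leNgt; apply/negP => c.
  have [uv|vu] := leP u v; last first.
    have m : t < (t + t') / 2 < t' by lra.
    by have := vb _ m; have := ua _ m; have := ab ((t + t') / 2); lra.
  (* Small enough for the points [t + e] and [t' - e] to violate the bound [c]
     as well. *)
  pose e := (t' - t - 3 / 2 * (v - u)) / 4.
  have e0 : 0 < e by rewrite /e; lra.
  have eE : 4 * e = t' - t - 3 / 2 * (v - u) by rewrite /e; lra.
  have m : t < t + e < t' by lra.
  have m' : t < t' - e < t' by lra.
  have := vb _ m'; have := ua _ m; have := @ba (t + e) (t' - e).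
  by have := ab (t + e); have := ab (t' - e); lra.
have mono u v : u <= v -> phi u <= phi v.
  move=> uv; rewrite leNgt; apply/negP => vu.
  by have := spread _ _ _ _ (phiP v) (phiP u) vu; lra.
exists phi, a, b; split => //.
- have lip u v : u <= v -> `|phi u - phi v| <= 3 / 2 * `|u - v|.
    move=> uv; rewrite distrC [`|u - v|]distrC !ger0_norm ?subr_ge0//; last exact: mono.
    have := mono _ _ uv; rewrite le_eqVlt => /predU1P[->|]; first by lra.
    by move=> /(spread _ _ _ _ (phiP u) (phiP v)); lra.
  move=> u v; have [/lip//|/ltW/lip] := leP u v.
  by rewrite distrC [`|v - u|]distrC.
- by move=> u; case: (phiP u).
- move=> t /andP[t0 t1]; split => //.
  + by have := dyadic_weight_ge0 R (fun i => d i < t); rewrite /a /wa; lra.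
  + by have := dyadic_weight_le1 R (fun i => d i <= t); rewrite /b /wb; lra.
  + move=> u /andP[au ub].
    have su : sp u t.
      split; first by rewrite t0.
        by move=> s /andP[_ st]; have := ba _ _ st; lra.
      by move=> s /andP[ts _]; have := ba _ _ ts; lra.
    apply/eqP; rewrite eq_le !leNgt; apply/andP; split; apply/negP.
      by move=> tu; have := spread _ _ _ _ su (phiP u) tu; lra.
    by move=> ut; have := spread _ _ _ _ (phiP u) su ut; lra.
- move=> n; rewrite /a /b ltrD2l ltr_pM2l//.
  by apply: (@dyadic_weight_lt R _ _ n) => [i /ltW//||]; rewrite ?ltxx ?lexx.
Qed.

(** * Level sets of a function that is cut between levels *)

Section Levels.
Context (R : realType) (X : metricType R).

(** Reversal of the interval: statements about the part above a level follow
from those about the part below. *)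
Lemma cut_betweenN (h : X -> R) : cut_between h -> cut_between (\- h).
Proof.
move=> hc s t st; have [|z zP] := hc (- t) (- s); first by rewrite ltrN2.
exists z => V a b cV Va Vb /= has tb; apply: (zP V b a) => //; first by rewrite lerNr.
by rewrite lerNl.
Qed.

(** Around two such points take disjoint connected neighbourhoods. Both go from
a level below [t] up to [t], so both contain the point that [cut_between]
provides for a pair of levels just below [t]. *)
Lemma closure_lt_unique (h : X -> R) (t : R) (x y : X) :
  locally_connected_space X -> cut_between h ->
  closure [set z | h z < t] x -> h x = t ->
  closure [set z | h z < t] y -> h y = t -> x = y.
Proof.
move=> lc hc Lx hx Ly hy; apply/eqP; apply: contraT; rewrite -mdist_gt0 => xy.
have d0 : 0 < mdist x y / 2 by rewrite divr_gt0.
have [V [oV Vx cV Vb]] := lc _ _ (nbhsx_ballx x _ d0).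
have [W [oW Wy cW Wb]] := lc _ _ (nbhsx_ballx y _ d0).
have [a [/= ha Va]] := Lx V (open_nbhs_nbhs (conj oV Vx)).
have [b [/= hb Wc]] := Ly W (open_nbhs_nbhs (conj oW Wy)).
have [|z zP] := hc (Num.max (h a) (h b)) t; first by rewrite gt_max ha.
have Vz : V z by apply: (zP V a x) => //; rewrite ?le_max ?lexx// hx.
have Wz : W z by apply: (zP W b y) => //; rewrite ?le_max ?lexx ?orbT// hy.
have := Vb _ Vz; have := Wb _ Wz; rewrite !ballEmdist /= => yz xz.
by have := metric_triangle x z y; rewrite (metric_sym z y); lra.
Qed.

(** Points just below the level [t] are close to the part of the level that is
adherent to the points below: outside [U], the values of [h] on the closure form
a compact set that does not contain [t]. *)
Lemma closure_lt_squeeze (h : X -> R) (t : R) (U : set X) :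
  compact [set: X] -> continuous h -> open U ->
  closure [set z | h z < t] `&` [set z | h z = t] `<=` U ->
  exists2 d, 0 < d & forall x, t - d < h x < t -> U x.
Proof.
move=> kX ch oU LU; pose K := closure [set z | h z < t] `&` ~` U.
have kK : compact K.
  apply: (subclosed_compact _ kX) => //; apply: closedI; first exact: closed_closure.
  exact: open_closedC.
have khK : compact (h @` K) by apply: continuous_compact => //; exact: continuous_subspaceT.
have chK : closed (h @` K) by apply: compact_closed => //; exact: norm_hausdorff.
have nt : (~` (h @` K)) t by move=> [x [Lx nUx] hx]; apply: nUx; apply: LU.
have /nbhs_ballP[d /= d0 db] : nbhs t (~` (h @` K)).
  by apply: open_nbhs_nbhs; split => //; exact: closed_openC.
exists d => // x /andP[dx xt]; apply: contrapT => nUx.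
apply: (db (h x)); last by exists x => //; split => //; exact: subset_closure.
by rewrite /ball /= ger0_norm; lra.
Qed.

Lemma closure_lt_le (h : X -> R) (t : R) (x : X) : continuous h ->
  closure [set z | h z < t] x -> h x <= t.
Proof.
move=> ch Lx; rewrite leNgt; apply/negP => tx.
have [z [/= zt]] := Lx _ (ch x _ (open_nbhs_nbhs (conj (@open_gt R t) tx))).
by move=> /(lt_trans zt); rewrite ltxx.
Qed.

Lemma closure_lt_exists (h : X -> R) (t : R) (x y : X) :
  connected [set: X] -> continuous h -> h x < t -> t <= h y ->
  exists z, closure [set z | h z < t] z /\ h z = t.
Proof.
move=> cX ch xt ty; apply: contrapT => nz.
apply: (@connected_split X setT [set z | h z < t] (~` closure [set z | h z < t]) x y) => //.
- exact: (open_comp (fun z _ => ch z) (@open_lt R t)).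
- exact/closed_openC/closed_closure.
- move=> z _; have [Lz|] := pselect (closure [set z | h z < t] z); last by right.
  left => /=; rewrite lt_neqAle closure_lt_le// andbT.
  by apply/eqP => hz; apply: nz; exists z.
- by move=> z _ zt; apply; exact: subset_closure.
- move=> Ly; apply: nz; exists y; split => //; apply/eqP.
  by rewrite eq_le ty andbT; exact: closure_lt_le.
Qed.

End Levels.

Section Fibres.
Context (R : realType) (X : metricType R) (p q : X) (h : X -> R).
Hypothesis peanoX : peano_continuum X.
Hypothesis ch : continuous h.
Hypothesis hp : h p = 0.
Hypothesis hq : h q = 1.
Hypothesis hcut : cut_between h.

Let cX : connected [set: X]. Proof. by case: peanoX => [[]]. Qed.
Let kX : compact [set: X]. Proof. by case: peanoX => [[]]. Qed.
Let lcX : locally_connected_space X. Proof. by case: peanoX. Qed.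

Let chN : continuous (\- h).
Proof. by move=> x; apply: cvgN; exact: ch. Qed.

Let gtE t : [set z | t < h z] = [set z | (\- h) z < - t].
Proof. by apply/funext => z; rewrite /= ltrN2. Qed.

Let below t := [set z | h z < t].
Let above t := [set z | t < h z].

Lemma below_unique t x y : closure (below t) x -> h x = t ->
  closure (below t) y -> h y = t -> x = y.
Proof. exact: (closure_lt_unique lcX hcut). Qed.

Lemma above_unique t x y : closure (above t) x -> h x = t ->
  closure (above t) y -> h y = t -> x = y.
Proof.
rewrite /above gtE => Ux hx Uy hy.
by apply: (closure_lt_unique lcX (cut_betweenN hcut) Ux _ Uy) => /=; rewrite ?hx ?hy.
Qed.

(** The default values matter at the two ends: nothing is below the level [0],
whose entry is the starting point [p], and nothing above the level [1], whose
exit is [q]. *)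
Definition entry t := xget p (closure (below t) `&` [set z | h z = t]).
Definition exit t := xget q (closure (above t) `&` [set z | h z = t]).

Lemma entry_unique t x : closure (below t) x -> h x = t -> x = entry t.
Proof.
move=> Lx hx; rewrite /entry; case: xgetP => [y _ [Ly hy]|/(_ x)[]//].
exact: below_unique Lx hx Ly hy.
Qed.

Lemma exit_unique t x : closure (above t) x -> h x = t -> x = exit t.
Proof.
move=> Lx hx; rewrite /exit; case: xgetP => [y _ [Ly hy]|/(_ x)[]//].
exact: above_unique Lx hx Ly hy.
Qed.

Lemma level_entry t : 0 <= t <= 1 -> h (entry t) = t.
Proof.
move=> /andP[]; rewrite le_eqVlt => /predU1P[<- _|t0 t1]; rewrite /entry.
  by case: xgetP => [y _ []//|_].
case: xgetP => [y _ []//|nL].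
have [||z Lz] := @closure_lt_exists R X h t p q cX ch; rewrite ?hp ?hq//.
by case: (nL z).
Qed.

Lemma level_exit t : 0 <= t <= 1 -> h (exit t) = t.
Proof.
move=> /andP[t0]; rewrite le_eqVlt => /predU1P[->|t1]; rewrite /exit.
  by case: xgetP => [y _ []//|_].
case: xgetP => [y _ []//|nL].
have [||z [Lz /= /oppr_inj hz]] := @closure_lt_exists R X (\- h) (- t) q p cX chN.
- by rewrite /= hq ltrN2.
- by rewrite /= hp lerN2.
by case: (nL z); rewrite /above gtE.
Qed.

Definition fibre_retract t x :=
  if h x < t then entry t else if t < h x then exit t else x.

Lemma fibre_retract_lt t x : h x < t -> fibre_retract t x = entry t.
Proof. by rewrite /fibre_retract => ->. Qed.

Lemma fibre_retract_gt t x : t < h x -> fibre_retract t x = exit t.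
Proof. by rewrite /fibre_retract => xt; rewrite xt ltNge ltW. Qed.

Lemma fibre_retract_id t x : h x = t -> fibre_retract t x = x.
Proof. by rewrite /fibre_retract => ->; rewrite ltxx. Qed.

Lemma level_retract t x : 0 <= t <= 1 -> h (fibre_retract t x) = t.
Proof.
move=> t01; have [xt|xt|xt] := ltgtP (h x) t.
- by rewrite fibre_retract_lt// level_entry.
- by rewrite fibre_retract_gt// level_exit.
- by rewrite fibre_retract_id.
Qed.

(** On the level itself the map is the identity; a point of the level that is
adherent to the part below can only be the entry, the value taken on that part,
and likewise for the part above. *)
Lemma fibre_retract_continuous t : continuous (fibre_retract t).
Proof.
move=> x; have [xt|xt|xt] := ltgtP (h x) t.
- have nt := (ch (open_nbhs_nbhs (conj (@open_lt R t) xt))).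
  apply: (@cvg_trans _ ((fun=> entry t) @ x)); last by rewrite fibre_retract_lt//; exact: cvg_cst.
  apply: near_eq_cvg; near=> y; rewrite fibre_retract_lt//; near: y.
  exact: nt.
- have nt := (ch (open_nbhs_nbhs (conj (@open_gt R t) xt))).
  apply: (@cvg_trans _ ((fun=> exit t) @ x)); last by rewrite fibre_retract_gt//; exact: cvg_cst.
  apply: near_eq_cvg; near=> y; rewrite fibre_retract_gt//; near: y.
  exact: nt.
- rewrite /continuous_at fibre_retract_id// => U nU.
  have lo : \forall y \near x, h y < t -> U (entry t).
    have [Lx|nLx] := pselect (closure (below t) x).
      by rewrite -(entry_unique Lx xt); near=> y => _; exact: nbhs_singleton.
    have : nbhs x (~` closure (below t)).
      by apply: open_nbhs_nbhs; split => //; exact/closed_openC/closed_closure.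
    by apply: filterS => y nLy yt; exfalso; apply: nLy; exact: subset_closure.
  have up : \forall y \near x, t < h y -> U (exit t).
    have [Lx|nLx] := pselect (closure (above t) x).
      by rewrite -(exit_unique Lx xt); near=> y => _; exact: nbhs_singleton.
    have : nbhs x (~` closure (above t)).
      by apply: open_nbhs_nbhs; split => //; exact/closed_openC/closed_closure.
    by apply: filterS => y nLy yt; exfalso; apply: nLy; exact: subset_closure.
  suff : \forall y \near x, U (fibre_retract t y) by [].
  near=> y; have [yt|yt|yt] := ltgtP (h y) t.
  + by rewrite /= fibre_retract_lt//; move: yt; near: y.
  + by rewrite /= fibre_retract_gt//; move: yt; near: y.
  + by rewrite /= fibre_retract_id//; near: y.
Unshelve. all: by end_near. Qed.

(** Otherwise the closures of the part below and of the part above cover [X].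
The level has at most one point in each of them, so its two points are
distributed between them; then the closures are disjoint, against
connectedness. *)
Lemma fibre_interior t x y : x <> y -> h x = t -> h y = t ->
  exists W : set X, [/\ open W, W !=set0 & forall z, W z -> h z = t].
Proof.
move=> xy hx hy; exists (~` closure (below t) `&` ~` closure (above t)); split.
- by apply: openI; exact/closed_openC/closed_closure.
- apply: contrapT => /set0P/negP/negPn/eqP E.
  have cov z : closure (below t) z \/ closure (above t) z.
    apply: contrapT => /not_orP nz.
    by rewrite -[False]/((set0 : set X) z) -E; split; case: nz.
  wlog : x y xy hx hy / closure (below t) x /\ closure (above t) y.
    move=> W; have [Lx|Ux] := cov x; have [Ly|Uy] := cov y.
    + by apply: xy; exact: below_unique Lx hx Ly hy.
    + by apply: (W x y).
    + by apply: (W y x) => //; exact: nesym.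
    + by apply: xy; exact: above_unique Ux hx Uy hy.
  move=> [Lx Uy].
  have dj z : closure (below t) z -> closure (above t) z -> False.
    move=> Lz Uz; have hz : h z = t.
      apply/eqP; rewrite eq_le (closure_lt_le ch Lz)/=.
      by rewrite /above gtE in Uz; have := closure_lt_le chN Uz; rewrite /= lerN2.
    by apply: xy; rewrite (below_unique Lx hx Lz hz) (above_unique Uz hz Uy hy).
  apply: (@connected_split X setT (~` closure (above t)) (~` closure (below t)) x y) => //.
  + exact/closed_openC/closed_closure.
  + exact/closed_openC/closed_closure.
  + by move=> z _; have [Lz|Uz] := cov z; [left=> /(dj z Lz)|right=> /dj/(_ Uz)].
  + by move=> z _ nU nL; case: (cov z).
  + exact: dj.
  + by move=> /dj/(_ Uy).
- move=> z [nL nU]; have [zt|zt|//] := ltgtP (h z) t.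
    by exfalso; apply: nL; exact: subset_closure.
  by exfalso; apply: nU; exact: subset_closure.
Qed.

End Fibres.

(** * A path along the level sets *)

(** At the time [u] the path is on the level [phi u]; during the time interval
from [a t] to [b t] that is reserved for the level [t] it follows the
retraction of the whole path [gam] to this level. *)
Lemma monotone_path (R : realType) (X : metricType R) :
  peano_continuum X -> ~ countable (cut_points X) ->
  exists (h : X -> R) (g : R -> X),
  [/\ continuous h, continuous g, range h = `[0, 1]%classic,
      forall u v, `|h (g u) - h (g v)| <= 3 / 2 * `|u - v| &
      forall x, exists2 u, 0 <= u <= 1 & g u = x].
Proof.
move=> PX nc; have [ctX _] := PX; have [X0 _ kX] := ctX.
have [p [q [h [ch h01 hp hq hcut]]]] := cut_function ctX nc.
have [gam [cgam gam0 gam1 gamS]] := peano_path p q PX.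
have [d dd] := dense_sequence X0 (second_countable_compact X0 kX).
have [phi [a [b [phimono philip phi01 ab abd]]]] := staircase (h \o d).
pose ret := fibre_retract p q h.
(* When [a t = b t] the quotient is 0, because the inverse of 0 is 0. *)
pose local t u := ret t (gam ((u - a t) / (b t - a t))).
pose g u := local (phi u) u.
have hg u : h (g u) = phi u by exact: level_retract.
have clocal t : continuous (local t).
  move=> u; apply: continuous_comp; last exact: fibre_retract_continuous.
  apply: continuous_comp; last exact: cgam.
  apply: cvgM; last exact: cvg_cst.
  by apply: cvgB; [exact: cvg_id|exact: cvg_cst].
(* A level for which no time is reserved has a single point. *)
have flat x y : h x = h y -> a (h x) = b (h x) -> x = y.
  move=> hxy abx; apply: contrapT => xy.
  have [W [oW W0 Wh]] := fibre_interior PX ch hcut xy erefl (esym hxy).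
  have [z [Wz [n _ nz]]] := dd W W0 oW; rewrite -nz in Wz.
  by have := abd n; rewrite /= (Wh _ Wz) abx ltxx.
have cphi : continuous phi.
  move=> u; apply/cvgrPdist_lt => e e0.
  have e1 : 0 < e / 2 by rewrite divr_gt0.
  apply: filterS (nbhsx_ballx u _ e1) => v; rewrite /ball /= => uv.
  by have := philip u v; lra.
exists h, g; split => //; last first.
- move=> x; have [a0 aleb b1 phiE] := ab _ (h01 x).
  have [ax|ax] := eqVneq (a (h x)) (b (h x)).
    exists (a (h x)); first by rewrite a0 (le_trans aleb).
    by apply: esym; apply: flat => //; rewrite hg phiE// lexx.
  have ltab : 0 < b (h x) - a (h x) by rewrite subr_gt0 lt_neqAle ax.
  have [v /andP[v0 v1] gv] := gamS x.
  pose u := a (h x) + v * (b (h x) - a (h x)).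
  have vd0 : 0 <= v * (b (h x) - a (h x)) by rewrite mulr_ge0// ltW.
  have vd1 : v * (b (h x) - a (h x)) <= b (h x) - a (h x) by rewrite ger_pMl.
  have uab : a (h x) <= u <= b (h x) by rewrite /u; lra.
  exists u; first by lra.
  rewrite /g (phiE _ uab) /local /u addrAC subrr add0r mulfK ?gt_eqF// gv.
  exact: fibre_retract_id.
- by move=> u v; rewrite !hg; exact: philip.
- apply/seteqP; split => [_ [x _ <-]|t] /=; rewrite in_itv/=; first exact: h01.
  by exists (entry p h t) => //; rewrite (level_entry PX ch hp hq).
- move=> u; have [a0 aleb b1 phiE] := ab _ (phi01 u).
  set t := phi u in a0 aleb b1 phiE.
  have t01 := phi01 u; rewrite -/t in t01.
  suff [lo up] : (forall U, nbhs (g u) U -> \forall v \near u, v <= u -> U (g v)) /\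
                 (forall U, nbhs (g u) U -> \forall v \near u, u <= v -> U (g v)).
    move=> U nU; suff : \forall v \near u, U (g v) by [].
    near=> v; have [vu|/ltW uv] := leP v u.
      by move: vu; near: v; exact: lo.
    by move: uv; near: v; exact: up.
  split=> U nU.
  (* Either the level [t] is already reached before [u], and then [local t]
     describes [g] there, or [u] is the moment at which it is reached: then
     [g u] is the entry, and what comes before is squeezed towards it. *)
  + have [[u0 u0u phiu0]|nu0] := pselect (exists2 u0, u0 < u & phi u0 = t).
      have nlocal : \forall v \near u, U (local t v) by exact: clocal nU.
      near=> v => vu; have -> : g v = local t v.
        rewrite /g (_ : phi v = t)//; apply/eqP; rewrite eq_le phimono//= -phiu0.
        by apply: phimono; apply: ltW; near: v; exact: lt_nbhsr.
      by near: v.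
    have phi_lt v : v < u -> phi v < t.
      move=> vu; rewrite lt_neqAle phimono ?ltW// andbT; apply/eqP => pv.
      by apply: nu0; exists v.
    have t0 : 0 < t.
      by have := phi_lt (u - 1); have := phi01 (u - 1); lra.
    have ua : u <= a t.
      rewrite leNgt; apply/negP => /phi_lt; rewrite phiE ?ltxx//.
      by rewrite lexx.
    have gu : g u = entry p h t.
      rewrite /g /local -/t gam0; first by apply: fibre_retract_lt; rewrite hp.
      by rewrite mulr_le0_ge0 ?invr_ge0; lra.
    have LU : closure [set z | h z < t] `&` [set z | h z = t] `<=` U^°.
      move=> z [Lz hz]; rewrite (entry_unique p PX hcut Lz hz) -gu.
      exact: nU.
    have [e e0 eU] := closure_lt_squeeze kX ch (@open_interior _ U) LU.
    have nphi : \forall v \near u, t - e < phi v.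
      have tu : t - e < phi u by rewrite -/t; lra.
      exact: (cphi u _ (open_nbhs_nbhs (conj (@open_gt R (t - e)) tu))).
    near=> v; rewrite le_eqVlt => /predU1P[->|/phi_lt vt]; first exact: nbhs_singleton.
    by apply: interior_subset; apply: eU; rewrite hg vt andbT; near: v.
  + have [[u1 u1u phiu1]|nu1] := pselect (exists2 u1, u < u1 & phi u1 = t).
      have nlocal : \forall v \near u, U (local t v) by exact: clocal nU.
      near=> v => uv; have -> : g v = local t v.
        rewrite /g (_ : phi v = t)//; apply/eqP.
        rewrite eq_le [X in _ && X]phimono// andbT -phiu1.
        by apply: phimono; apply: ltW; near: v; exact: lt_nbhsl.
      by near: v.
    have phi_gt v : u < v -> t < phi v.
      move=> uv; rewrite lt_neqAle phimono ?ltW// andbT; apply/eqP => pv.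
      by apply: nu1; exists v.
    have t1 : t < 1.
      by have := phi_gt (u + 1); have := phi01 (u + 1); lra.
    have bu : b t <= u.
      rewrite leNgt; apply/negP => /phi_gt; rewrite phiE ?ltxx//.
      by rewrite lexx aleb.
    have gu : g u = exit q h t.
      have [abt|abt] := eqVneq (a t) (b t).
        by apply: flat; rewrite hg -/t// (level_exit PX ch hp hq).
      rewrite /g /local -/t gam1; first by apply: fibre_retract_gt; rewrite hq.
      rewrite ler_pdivlMr ?mul1r; first by lra.
      by rewrite subr_gt0 lt_neqAle abt.
    have gtE : [set z | t < h z] = [set z | (\- h) z < - t].
      by apply/funext => z; rewrite /= ltrN2.
    have LU : closure [set z | (\- h) z < - t] `&` [set z | (\- h) z = - t] `<=` U^°.
      move=> z [Lz /= /oppr_inj hz]; rewrite -gtE in Lz.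
      rewrite (exit_unique q PX hcut Lz hz) -gu.
      exact: nU.
    have chN : continuous (\- h) by move=> x; apply: cvgN; exact: ch.
    have [e e0 eU] := closure_lt_squeeze kX chN (@open_interior _ U) LU.
    have nphi : \forall v \near u, phi v < t + e.
      have tu : phi u < t + e by rewrite -/t; lra.
      exact: (cphi u _ (open_nbhs_nbhs (conj (@open_lt R (t + e)) tu))).
    near=> v; rewrite le_eqVlt => /predU1P[<-|/phi_gt vt]; first exact: nbhs_singleton.
    apply: interior_subset; apply: eU; rewrite /= hg ltrN2 vt andbT.
    by rewrite -opprD ltrN2; near: v.
Unshelve. all: by end_near. Qed.

(** * The witnessing maps *)

Lemma uniformly_continuous_itv (R : realType) (X : metricType R) (g : R -> X) (e : R) :
  continuous g -> 0 < e -> exists2 d, 0 < d &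
    forall u v, 0 <= u <= 1 -> `|u - v| < d -> mdist (g u) (g v) < e.
Proof.
move=> cg e0; have e2 : 0 < e / 2 by rewrite divr_gt0.
have /compact_near_coveringP cov := @segment_compact R 0 1.
have /cov : forall x : R, `[0, 1]%classic x -> \forall x' \near x & d \near (0 : R)^'+,
    forall v, `|x' - v| < d -> mdist (g x') (g v) < e.
  move=> x _.
  have /nbhs_ballP[r /= r0 rb] := cg x _ (nbhsx_ballx (g x) _ e2).
  have r2 : 0 < r / 2 by rewrite divr_gt0.
  exists (ball x (r / 2), [set d | d < r / 2]).
    by split; [exact: nbhsx_ballx|exact: nbhs_right_lt].
  move=> [x' d] [/= xx' /= dr] v x'v.
  have gx' : ball (g x) (e / 2) (g x').
    by apply: rb; apply: le_ball xx'; lra.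
  have gv : ball (g x) (e / 2) (g v).
    apply: rb; move: xx'; rewrite /ball /= => xx'.
    rewrite (le_lt_trans (ler_distD x' _ _))// [ltRHS]splitr ltrD//.
    exact: lt_trans x'v dr.
  move: gx' gv; rewrite !ballEmdist /= => gx' gv.
  by have := metric_triangle (g x') (g x) (g v); rewrite (metric_sym (g x') (g x)); lra.
move=> near0.
have [d [d0 dP]] : exists d : R, 0 < d /\
    `[0, 1]%classic `<=` (fun x' => forall v, `|x' - v| < d -> mdist (g x') (g v) < e).
  have pos : \forall d \near (0 : R)^'+, 0 < d by exact: nbhs_right_gt.
  by have [d [d0 dP]] := filter_ex (filterI pos near0); exists d.
by exists d => // u v u01; apply: dP; rewrite /= in_itv.
Qed.

(** The only map would be onto, and so would its iterates, whose images then have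
the diameter of [X]. *)
Lemma singleton_not_witnessing (R : realType) (X : metricType R)
    (F : set (X -> X)) (x y : X) :
  x <> y -> witnessing_family F -> (forall f g, F f -> F g -> f = g) -> False.
Proof.
move=> xy [_ _ contr cover] F1.
have [f Ff _] : (\bigcup_(f in F) range f) x by rewrite cover.
have fsurj z : exists t, f t = z.
  have [f' Ff' [t _ ft]] : (\bigcup_(f in F) range f) z by rewrite cover.
  by exists t; rewrite (F1 _ _ Ff Ff').
have d0 : 0 < mdist x y by rewrite mdist_gt0; exact/eqP.
have [k /(_ (iter k f))] := contr _ d0.
have Fk : family_iter F k (iter k f).
  elim: k => [|k IH] //=; exists f => //; exists (iter k f) => //.
have ksurj z : exists t, iter k f t = z.
  elim: {Fk} k z => [|k IH] z; first by exists z.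
  by have [t <-] := fsurj z; have [s <-] := IH t; exists s.
move=> /(_ Fk); rewrite ltNge => /negP; apply.
have [s sx] := ksurj x; have [t ty] := ksurj y.
by apply: ereal_sup_ubound; exists x; [exists s|exists y => //; exists t].
Qed.

Lemma witnessing_ge2 (R : realType) (X : metricType R)
    (F : set (X -> X)) (x y : X) m :
  x <> y -> witnessing_family F -> (F #= `I_m)%card -> (1 < m)%N.
Proof.
move=> xy wF Fm; rewrite ltnNge; apply/negP => m1.
apply: (singleton_not_witnessing xy wF) => f g Ff Fg.
have : (F #<= `I_1)%card by rewrite (card_le_eql Fm) card_le_II.
move=> /pcard_leP[e].
have e0 f' : F f' -> e f' = 0%N.
  move=> Ff'; have : `I_1 (e f') by exact: funS.
  by rewrite /= ltnS leqn0 => /eqP.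
by apply: (@inj _ _ _ e); rewrite ?inE//; exact: etrans (e0 _ Ff) (esym (e0 _ Fg)).
Qed.

(** A member of the family composed with any map multiplies the variation of
[h] by at most [1 / 2 * (3 / 2)], so that after [k] steps it is at most
[(3 / 4) ^+ k]; one more step applies [g] to an interval of at most that
length. *)
Lemma witnessing_two_halves (R : realType) (X : metricType R) (h : X -> R) (g : R -> X) :
  continuous h -> continuous g -> range h = `[0, 1]%classic ->
  (forall u v, `|h (g u) - h (g v)| <= 3 / 2 * `|u - v|) ->
  (forall x, exists2 u, 0 <= u <= 1 & g u = x) ->
  witnessing_family [set (fun x => g (h x / 2)); (fun x => g ((h x + 1) / 2))].
Proof.
move=> ch cg hE hg gS; set F := [set _; _].
have h01 x : 0 <= h x <= 1.
  by have : range h (h x) by []; rewrite hE /= in_itv.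
have surj v : 0 <= v <= 1 -> exists y, h y = v.
  move=> v01; have [y _ <-] : range h v; last by exists y.
  by rewrite hE /= in_itv.
have FE f : F f -> exists2 c, 0 <= c <= 1 & f = fun x => g ((h x + c) / 2).
  move=> [->|->]; [exists 0; first by rewrite lexx ler01|exists 1 => //].
    by apply/funext => x; rewrite addr0.
  by rewrite lexx ler01.
have halve x y c : (h x + c) / 2 - (h y + c) / 2 = 2^-1 * (h x - h y) by lra.
have n2 (x : R) : `|2^-1 * x| = 2^-1 * `|x| by rewrite normrM ger0_norm ?invr_ge0.
have Flip k f : family_iter F k f ->
    forall x y, `|h (f x) - h (f y)| <= (3 / 4) ^+ k * `|h x - h y|.
  elim: k f => [|k IH] f; first by move=> -> x y; rewrite expr0 mul1r.
  move=> [f1 /FE[c c01 ->] [f2 /IH f2P <-]] x y /=.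
  apply: (le_trans (hg _ _)); rewrite halve n2 exprS; have := f2P x y.
  by move=> f2xy; rewrite -[leRHS]mulrA; lra.
split.
- exact: finite_set2.
- move=> f /FE[c _ ->] x; apply: (@continuous_comp _ _ _ (fun x => (h x + c) / 2) g); last exact: cg.
  apply: cvgM; last exact: cvg_cst.
  by apply: cvgD; [exact: ch|exact: cvg_cst].
- move=> e e0; have e2 : 0 < e / 2 by rewrite divr_gt0.
  have [d d0 dP] := uniformly_continuous_itv cg e2.
  have [k kd] : exists k, (3 / 4 : R) ^+ k < d.
    have : (fun k => (3 / 4 : R) ^+ k) @ \oo --> 0.
      by apply: cvg_expr; rewrite ger0_norm; lra.
    move=> /cvgrPdist_lt/(_ d d0)[k _ /(_ k (leqnn k))]/=.
    have k0 : 0 <= (3 / 4 : R) ^+ k by apply: exprn_ge0; lra.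
    by rewrite sub0r normrN (ger0_norm k0) => kd; exists k.
  exists k.+1 => _ [f1 /FE[c c01 ->] [f2 /Flip f2P <-]].
  apply: (@le_lt_trans _ _ (e / 2)%:E); last by rewrite lte_fin; lra.
  apply: ge_ereal_sup => _ [_ [x _ <-] [_ [y _ <-] <-]] /=.
  rewrite lee_fin ltW//; apply: dP; first by have := h01 (f2 x); lra.
  rewrite halve n2; apply: le_lt_trans kd.
  have := f2P x y; have hxy : `|h x - h y| <= 1.
    by rewrite ler_norml; have := h01 x; have := h01 y; lra.
  have k0 : 0 <= (3 / 4 : R) ^+ k by apply: exprn_ge0; lra.
  have : (3 / 4 : R) ^+ k * `|h x - h y| <= (3 / 4) ^+ k by rewrite ler_piMr.
  by have := normr_ge0 (h (f2 x) - h (f2 y)); lra.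
- apply/seteqP; split => // x _; have [u u01 gu] := gS x.
  have [u2|u2] := leP u (1 / 2).
    have [|y hy] := surj (2 * u); first by lra.
    exists (fun x => g (h x / 2)); first by left.
    by exists y => //; rewrite hy -gu; congr g; lra.
  have [|y hy] := surj (2 * u - 1); first by lra.
  exists (fun x => g ((h x + 1) / 2)); first by right.
  by exists y => //; rewrite hy -gu; congr g; lra.
Qed.

Theorem theorem14 (R : realType) (X : metricType R)
    (hX : peano_continuum X) (hcut : ~ countable (cut_points X)) :
  topological_fractal X /\ has_witnessing_number X 2.
Proof.
have [[_ _ kX] _] := hX.
have [h [g [ch cg hE hg gS]]] := monotone_path hX hcut.
have wF := witnessing_two_halves ch cg hE hg gS.
set F := [set _; _] in wF.
have [x [y xy]] : exists x y : X, x <> y.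
  apply: contrapT => nxy; apply: hcut.
  have [[p _] _ _] := hX.1; apply: sub_countable (countable1 p).
  apply: subset_card_le => q _ /=; apply: contrapT => qp.
  by apply: nxy; exists q, p.
split; first by split=> //; exists F.
split; last by move=> F' m wF'; exact: witnessing_ge2 xy wF'.
exists F => //; have [m Fm] : finite_set F by case: wF.
(* The upper bound comes from listing the two maps, so that they need not be
   shown to be distinct. *)
suff <- : m = 2%N by [].
apply/eqP; rewrite eqn_leq (witnessing_ge2 xy wF Fm) andbT.
rewrite -card_le_II -(card_le_eql Fm).
have -> : F = (fun i : nat => if i is 0%N then fun x => g (h x / 2)
                              else fun x => g ((h x + 1) / 2)) @` `I_2.
  apply/seteqP; split => f.
    by move=> [->|->]; [exists 0%N|exists 1%N].
  by move=> [[|i] _ <-]; [left|right].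
exact: card_image_le.
Qed.
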